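(* Let $A$, $B$, $C$ be vector bundles over $M$. (a) Let $A$ and $B$ be Lie algebroids and suppose that a $2$-representation $(\partial_B:C\to B,\nabla^{AB},\nabla^{AC},R_{AB})$ of $A$ and a $2$-representation $(\partial_A:C\to A,\nabla^{BA},\nabla^{BC},R_{BA})$ of $B$ form a matched pair. Then $(A\oplus B)\oplus C\to M$ is a split Lie $2$-algebroid (with $A\oplus B$ in the role of the anchored vector bundle $Q$ and $C$ in the role of $B^*$) with anchor $\rho_A\circ\mathrm{pr}_A+\rho_B\circ\mathrm{pr}_B$, $l_1:C\to A\oplus B$, $l_1(c)=(-\partial_Ac,\partial_Bc)$, bracket $$[\![(a,b),(a',b')]\!]=([a,a']+\nabla_ba'-\nabla_{b'}a,\ [b,b']+\nabla_ab'-\nabla_{a'}b),$$ connection $\nabla_{(a,b)}c=\nabla_ac+\nabla_bc$ on $C$, and $$l_3((a_1,b_1),(a_2,b_2),(a_3,b_3))=R_{AB}(a_1,a_2)b_3+R_{AB}(a_2,a_3)b_1+R_{AB}(a_3,a_1)b_2-R_{BA}(b_1,b_2)a_3-R_{BA}(b_2,b_3)a_1-R_{BA}(b_3,b_1)a_2.$$ This split Lie $2$-algebroid is called the double (bicrossproduct) of the matched pair. (b) Conversely, suppose $(A\oplus B)\oplus C$ has a split Lie $2$-algebroid structure such that 1. $[\![(a_1,0),(a_2,0)]\!]=([a_1,a_2],0)$ with a section $[a_1,a_2]\in\Gamma(A)$ for all $a_1,a_2\in\Gamma(A)$, and $[\![(0,b_1),(0,b_2)]\!]=(0,[b_1,b_2])$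 with a section $[b_1,b_2]\in\Gamma(B)$ for all $b_1,b_2\in\Gamma(B)$; and 2. $l_3((a_1,0),(a_2,0),(a_3,0))=0$ and $l_3((0,b_1),(0,b_2),(0,b_3))=0$ for all $a_i\in\Gamma(A)$, $b_i\in\Gamma(B)$. Then $A$ and $B$ are Lie subalgebroids of $(A\oplus B)\oplus C$, and $(A\oplus B)\oplus C$ is the double of a matched pair of $2$-representations of $A$ on $B\oplus C$ and of $B$ on $A\oplus C$. The $2$-representation of $A$ is given by $\partial_B(c)=\mathrm{pr}_B(l_1(c))$, $\nabla_ab=\mathrm{pr}_B[\![(a,0),(0,b)]\!]$, $\nabla_ac=\nabla_{(a,0)}c$, $R_{AB}(a_1,a_2)b=l_3(a_1,a_2,b)$, and the $2$-representation of $B$ by $\partial_A(c)=-\mathrm{pr}_A(l_1(c))$, $\nabla_ba=\mathrm{pr}_A[\![(0,b),(a,0)]\!]$, $\nabla_bc=\nabla_{(0,b)}c$, $R_{BA}(b_1,b_2)a=-l_3(b_1,b_2,a)$.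
   Context: **$2$-representations.** A $2$-representation of a Lie algebroid $A$ on a complex $\partial:E_0\to E_1$: $A$-connections $\nabla^0,\nabla^1$ on $E_0,E_1$ with $\partial\nabla^0=\nabla^1\partial$ and $R\in\Omega^2(A,\mathrm{Hom}(E_1,E_0))$ with $R_{\nabla^0}=R\circ\partial$, $R_{\nabla^1}=\partial\circ R$, $\mathbf d_{\nabla^{\mathrm{Hom}}}R=0$. Here $\nabla^{AB},\nabla^{AC}$ are $A$-connections on $B,C$, $R_{AB}\in\Omega^2(A,\mathrm{Hom}(B,C))$; $\nabla^{BA},\nabla^{BC}$ are $B$-connections on $A,C$, $R_{BA}\in\Omega^2(B,\mathrm{Hom}(A,C))$. All four connections are written $\nabla$. **Matched pair of $2$-representations.** For all $a,a_i\in\Gamma(A)$, $b,b_i\in\Gamma(B)$, $c,c_i\in\Gamma(C)$: (1) $\nabla_{\partial_Ac_1}c_2-\nabla_{\partial_Bc_2}c_1=-\nabla_{\partial_Ac_2}c_1+\nabla_{\partial_Bc_1}c_2$; (2) $[a,\partial_Ac]=\partial_A(\nabla_ac)-\nabla_{\partial_Bc}a$; (3) $[b,\partial_Bc]=\partial_B(\nabla_bc)-\nabla_{\partial_Ac}b$; (4) $\nabla_b\nabla_ac-\nabla_a\nabla_bc-\nabla_{\nabla_ba}c+\nabla_{\nabla_ab}c=R_{BA}(b,\partial_Bc)a-R_{AB}(a,\partial_Ac)b$; (5) $\partial_A(R_{AB}(a_1,a_2)b)=-\nabla_b[a_1,a_2]+[\nabla_ba_1,a_2]+[a_1,\nabla_ba_2]+\nabla_{\nabla_{a_2}b}a_1-\nabla_{\nabla_{a_1}b}a_2$;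 (6) $\partial_B(R_{BA}(b_1,b_2)a)=-\nabla_a[b_1,b_2]+[\nabla_ab_1,b_2]+[b_1,\nabla_ab_2]+\nabla_{\nabla_{b_2}a}b_1-\nabla_{\nabla_{b_1}a}b_2$; (7) $\mathbf d_{\nabla^A}R_{BA}=\mathbf d_{\nabla^B}R_{AB}\in\Omega^2(A,\wedge^2B^*\otimes C)=\Omega^2(B,\wedge^2A^*\otimes C)$, with $R_{BA}$ seen in $\Omega^1(A,\wedge^2B^*\otimes C)$, $R_{AB}$ in $\Omega^1(B,\wedge^2A^*\otimes C)$, and $\nabla^A$, $\nabla^B$ the induced connections on $\wedge^2B^*\otimes C$, $\wedge^2A^*\otimes C$. **Split Lie $2$-algebroid** $Q\oplus B^*\to M$: an anchored vector bundle $(Q,\rho_Q:Q\to TM)$, a vector bundle $B$, a vector bundle map $l_1:B^*\to Q$, a skew-symmetric dull bracket $[\![\cdot,\cdot]\!]$ on $\Gamma(Q)$ (i.e. $\rho_Q[\![q_1,q_2]\!]=[\rho_Q(q_1),\rho_Q(q_2)]$ and $[\![q_1,fq_2]\!]=f[\![q_1,q_2]\!]+\rho_Q(q_1)(f)q_2$), a linear connection $\nabla:\Gamma(Q)\times\Gamma(B)\to\Gamma(B)$ with dual $\nabla^*$ on $B^*$, and $l_3\in\Omega^3(Q,B^* )$, such that (i) $\nabla^*_{l_1(\beta_1)}\beta_2+\nabla^*_{l_1(\beta_2)}\beta_1=0$; (ii) $[\![q,l_1(\beta)]\!]=l_1(\nabla^*_q\beta)$; (iii) $\mathrm{Jac}=-l_1\circ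 l_3$, with $\mathrm{Jac}(q_1,q_2,q_3)=[\![[\![q_1,q_2]\!],q_3]\!]+[\![q_2,[\![q_1,q_3]\!]]\!]-[\![q_1,[\![q_2,q_3]\!]]\!]$; (iv) $R_{\nabla^*}(q_1,q_2)\beta=l_3(q_1,q_2,l_1(\beta))$; (v) $\mathbf d_{\nabla^*}l_3=0$. In the claim $Q=A\oplus B$, the bundle $B^*$ of this definition is $C$, and the connection on $C$ is the one denoted $\nabla^*$ here. ''$A$ is a Lie subalgebroid'' means that $[\cdot,\cdot]$ of (b)1 and the restriction to $A$ of the anchor make $A$ a Lie algebroid, and similarly for $B$. *)

(* Defs.v *)
From HB Require Import structures.
From mathcomp Require Import all_boot all_order all_algebra.
From mathcomp Require Import boolp classical_sets functions cardinality reals.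
From mathcomp Require Import topology normedtype derive.

Set Implicit Arguments.
Unset Strict Implicit.
Unset Printing Implicit Defensive.

Import Order.TTheory GRing.Theory Num.Theory.
Import numFieldNormedType.Exports.

Local Open Scope classical_set_scope.
Local Open Scope ring_scope.

Section SmoothRn.
Context {R : realType} {n : nat}.
Implicit Types (U V : set 'rV[R]_n) (f g : 'rV[R]_n -> R).

Definition partial (i : 'I_n) f : 'rV[R]_n -> R := 'D_(delta_mx 0 i) f.

(* Ck and smooth_in are only used for open U. *)
Fixpoint Ck (k : nat) U f : Prop :=
  (forall x, U x -> {for x, continuous f}) /\
  if k is k'.+1 then
    forall i : 'I_n, (forall x, U x -> derivable f x (delta_mx 0 i)) /\
                     Ck k' U (partial i f)
  else True.

Definition smooth_in U f := forall k, Ck k U f.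

Lemma Ck_cts k U f : Ck k U f -> forall x, U x -> {for x, continuous f}.
Proof. by case: k => [|k] []. Qed.

Lemma Ck_S k U f : Ck k.+1 U f -> Ck k U f.
Proof.
elim: k f => [|k IH] f /=; first by case.
case=> cf df; split=> // i; have [dfi Cf] := df i; split=> //; exact: IH.
Qed.

Lemma Ck_sub k U V f : V `<=` U -> Ck k U f -> Ck k V f.
Proof.
move=> VU; elim: k f => [|k IH] f /= [cf df]; split=> //.
- by move=> x /VU /cf.
- by move=> x /VU /cf.
- by move=> i; have [dfi Cf] := df i; split; [move=> x /VU/dfi|exact: IH].
Qed.

Lemma Ck_local k U f :
  (forall x, U x -> exists V, [/\ open V, V x & Ck k (U `&` V) f]) -> Ck k U f.
Proof.
elim: k f => [|k IH] f loc /=; split=> //.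
- by move=> x Ux; have [V [_ Vx [cf _]]] := loc x Ux; apply: cf.
- by move=> x Ux; have [V [_ Vx [cf _]]] := loc x Ux; apply: cf.
- move=> i; split.
    move=> x Ux; have [V [_ Vx [_ df]]] := loc x Ux.
    by have [dfi _] := df i; apply: dfi.
  apply: IH => x Ux; have [V [oV Vx [_ df]]] := loc x Ux.
  by exists V; split=> //; have [_] := df i.
Qed.

Lemma open_near_eq U f g x : open U -> (forall y, U y -> f y = g y) -> U x ->
  \forall y \near x, f y = g y.
Proof.
move=> oU fg Ux; have : nbhs x U by apply: open_nbhs_nbhs.
by apply: filterS.
Qed.

Lemma near_eq_quot f g (v x : 'rV[R]_n) : (\forall y \near x, f y = g y) ->
  \forall h \near (0 : R)^',
    h^-1 *: ((f \o shift x) (h *: v) - f x) =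
    h^-1 *: ((g \o shift x) (h *: v) - g x).
Proof.
move=> fg; have fgx : f x = g x by apply: (nbhs_singleton fg).
have cvg0 : (fun h : R => h *: v + x) @ (0 : R) --> x.
  have : (fun h : R => h *: v + x) @ (0 : R) --> (0 : R) *: v + x.
    by apply: cvgD; [apply: cvgZr_tmp; exact: cvg_id|exact: cvg_cst].
  by rewrite scale0r add0r; exact.
apply: (@cvg_within _ _ (nbhs_filter _)).
have := cvg0 _ fg; rewrite /= nbhs_simpl /=.
by apply: filterS => h /= e; rewrite e fgx.
Qed.

Lemma near_eq_cvgq f g (v x : 'rV[R]_n) (l : R) :
  (\forall y \near x, f y = g y) ->
  h^-1 *: ((f \o shift x) (h *: v) - f x) @[h --> (0 : R)^'] --> l ->
  h^-1 *: ((g \o shift x) (h *: v) - g x) @[h --> (0 : R)^'] --> l.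
Proof.
move=> fg; apply: cvg_trans; apply: near_eq_cvg; exact: near_eq_quot.
Qed.

Lemma near_eq_derivable f g (v x : 'rV[R]_n) : (\forall y \near x, f y = g y) ->
  derivable f x v -> derivable g x v.
Proof.
by move=> fg /cvg_ex [l /= Hl]; apply/cvg_ex; exists l; apply: near_eq_cvgq Hl.
Qed.

Lemma near_eq_derive f g (v x : 'rV[R]_n) : (\forall y \near x, f y = g y) ->
  derivable f x v -> 'D_v g x = 'D_v f x.
Proof.
by move=> fg df; apply: cvg_lim => //; apply: near_eq_cvgq df.
Qed.

Lemma near_eq_cts f g (x : 'rV[R]_n) : (\forall y \near x, f y = g y) ->
  {for x, continuous f} -> {for x, continuous g}.
Proof.
move=> fg; rewrite /prop_for /continuous_at -(nbhs_singleton fg) => cf.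
apply: (cvg_trans _ cf); exact: (@near_eq_cvg _ _ (nbhs x) _ _ _ fg).
Qed.

Lemma Ck_ext k U f g : open U -> (forall x, U x -> f x = g x) ->
  Ck k U f -> Ck k U g.
Proof.
move=> oU; elim: k f g => [|k IH] f g fg [cf df].
  split=> // x Ux; have e := open_near_eq oU fg Ux.
  exact: near_eq_cts e (cf x Ux).
split.
  move=> x Ux; have e := open_near_eq oU fg Ux.
  exact: near_eq_cts e (cf x Ux).
move=> i; have [dfi Cf] := df i; split.
  move=> x Ux; apply: (near_eq_derivable (open_near_eq oU fg Ux)); exact: dfi.
apply: IH Cf => x Ux.
exact: esym (near_eq_derive (open_near_eq oU fg Ux) (dfi x Ux)).
Qed.

Lemma Ck_cst k U (c : R) : Ck k U (cst c).
Proof.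
elim: k c => [|k IH] c; first by split=> // x _; exact: cst_continuous.
split=> [x _|i]; first exact: cst_continuous.
split=> [x _|]; first exact: derivable_cst.
suff -> : partial i (cst c) = cst 0 by [].
by apply/funext => x; rewrite /partial derive_cst.
Qed.

Lemma Ck_add k U f g : open U -> Ck k U f -> Ck k U g -> Ck k U (f + g).
Proof.
move=> oU; elim: k f g => [|k IH] f g [cf df] [cg dg].
  by split=> // x Ux; apply: continuousD; [exact: cf|exact: cg].
split=> [x Ux|i]; first by apply: continuousD; [exact: cf|exact: cg].
have [dfi Cf] := df i; have [dgi Cg] := dg i; split=> [x Ux|].
  by apply: derivableD; [exact: dfi|exact: dgi].
apply: (Ck_ext oU _ (IH _ _ Cf Cg)) => x Ux.
by rewrite /partial deriveD //; [exact: dfi|exact: dgi].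
Qed.

Lemma Ck_mul k U f g : open U -> Ck k U f -> Ck k U g -> Ck k U (f * g).
Proof.
move=> oU; elim: k f g => [|k IH] f g Hf Hg.
  split=> // x Ux.
  by apply: continuousM; [exact: (Ck_cts Hf)|exact: (Ck_cts Hg)].
split=> [x Ux|i].
  by apply: continuousM; [exact: (Ck_cts Hf)|exact: (Ck_cts Hg)].
have [dfi Cf] := Hf.2 i; have [dgi Cg] := Hg.2 i; split=> [x Ux|].
  by apply: derivableM; [exact: dfi|exact: dgi].
apply: (@Ck_ext _ _ (f * partial i g + g * partial i f) _ oU).
  by move=> x Ux; rewrite /partial deriveM //; [exact: dfi|exact: dgi].
by apply: Ck_add => //; apply: IH => //; apply: Ck_S.
Qed.

End SmoothRn.

Record chart (R : realType) (n : nat) (M : topologicalType) := Chart {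
  cdom : set M;
  cmap : M -> 'rV[R]_n;
  cinv : 'rV[R]_n -> M;
  cdom_open : open cdom;
  cimg_open : open (cmap @` cdom);
  cmapK : forall x, cdom x -> cinv (cmap x) = x;
  cmap_cts : forall x, cdom x -> {for x, continuous cmap};
  cinv_cts : forall y, (cmap @` cdom) y -> {for y, continuous cinv} }.

(* The atlas need not be maximal: the smooth functions defined below are those
   of the maximal atlas it generates. *)
Record manifold (R : realType) := Manifold {
  mspace :> topologicalType;
  mdim : nat;
  m_hausdorff : hausdorff_space mspace;
  m_second_countable : @second_countable mspace;
  atlas : set (chart R mdim mspace);
  atlas_cover : forall x, exists2 c, atlas c & cdom c x;
  atlas_compat : forall c c', atlas c -> atlas c' -> forall i : 'I_mdim,
    smooth_in (cmap c @` (cdom c `&` cdom c'))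
              (fun y => cmap c' (cinv c y) 0 i) }.

Section SmoothFun.
Context {R : realType} {M : manifold R}.
Implicit Types (U V : set M) (f g : M -> R).

(* Only used for open U. *)
Definition smooth_on U f := forall c, atlas c ->
  smooth_in (cmap c @` (cdom c `&` U)) (f \o cinv c).

Lemma cimg_openI (c : chart R (mdim M) M) U : open U ->
  open (cmap c @` (cdom c `&` U)).
Proof.
move=> oU; have -> : cmap c @` (cdom c `&` U) =
    cmap c @` cdom c `&` cinv c @^-1` U.
  apply/seteqP; split=> [_ [x [dx Ux] <-]|_ [[x dx <-]]] /=.
    by split; [exists x|rewrite /= cmapK].
  by rewrite cmapK // => Ux; exists x.
rewrite openE => y [Dy Uy]; rewrite /interior.
have H1 : nbhs y (cmap c @` cdom c).
  by apply: open_nbhs_nbhs; split=> //; exact: cimg_open.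
have H2 : nbhs y (cinv c @^-1` U).
  by apply: (cinv_cts Dy); apply: open_nbhs_nbhs.
exact: (@filterI _ (nbhs y) _ _ _ H1 H2).
Qed.

Lemma smooth_sub U V f : V `<=` U -> smooth_on U f -> smooth_on V f.
Proof.
move=> VU sf c ac k; apply: Ck_sub (sf c ac k) => _ [x [dx Vx] <-].
by exists x => //; split=> //; apply: VU.
Qed.

Lemma smooth_local U f :
  (forall x, U x -> exists V, [/\ open V, V x & smooth_on (U `&` V) f]) ->
  smooth_on U f.
Proof.
move=> loc c ac k; apply: Ck_local => _ [x [dx Ux] <-].
have [V [oV Vx sf]] := loc x Ux.
exists (cmap c @` (cdom c `&` V)); split; first exact: cimg_openI.
  by exists x.
apply: Ck_sub (sf c ac k) => _ [[y [dy Uy] <-] [z [dz Vz] e]].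
exists y => //; split=> //; split=> //.
by rewrite -(cmapK dy) -e cmapK.
Qed.

Lemma smooth_ext U f g : open U -> (forall x, U x -> f x = g x) ->
  smooth_on U f -> smooth_on U g.
Proof.
move=> oU fg sf c ac k; apply: Ck_ext (sf c ac k); first exact: cimg_openI.
by move=> _ [x [dx Ux] <-] /=; rewrite cmapK // fg.
Qed.

Lemma smooth_cst U (k : R) : smooth_on U (cst k).
Proof. by move=> c ac j; exact: Ck_cst. Qed.

Lemma smooth_add U f g : open U -> smooth_on U f -> smooth_on U g ->
  smooth_on U (f + g).
Proof.
by move=> oU sf sg c ac k; apply: Ck_add (sf c ac k) (sg c ac k);
  exact: cimg_openI.
Qed.

Lemma smooth_mul U f g : open U -> smooth_on U f -> smooth_on U g ->
  smooth_on U (f * g).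
Proof.
by move=> oU sf sg c ac k; apply: Ck_mul (sf c ac k) (sg c ac k);
  exact: cimg_openI.
Qed.

Lemma smooth_opp U f : open U -> smooth_on U f -> smooth_on U (- f).
Proof.
move=> oU sf; have -> : - f = cst (-1) * f.
  by apply/funext => x; rewrite [LHS]/= /GRing.mul /= mulN1r.
by apply: smooth_mul => //; exact: smooth_cst.
Qed.

Definition smooth_pred : {pred M -> R} := fun f => `[< smooth_on setT f >].

Lemma smooth_predP f : reflect (smooth_on setT f) (f \in smooth_pred).
Proof. exact: asboolP. Qed.

Lemma smooth_subring : subring_closed smooth_pred.
Proof.
split.
- by apply/smooth_predP; exact: smooth_cst.
- move=> f g /smooth_predP sf /smooth_predP sg; apply/smooth_predP.
  by apply: smooth_add sf (smooth_opp _ sg); exact: openT.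
- move=> f g /smooth_predP sf /smooth_predP sg; apply/smooth_predP.
  by apply: smooth_mul sf sg; exact: openT.
Qed.

HB.instance Definition _ :=
  GRing.isSubringClosed.Build (M -> R) smooth_pred smooth_subring.

End SmoothFun.

(* M may be empty, and then this is the zero ring: hence no nzRingType. *)
Record Cinf (R : realType) (M : manifold R) := MkCinf {
  cf :> M -> R;
  cf_mem : cf \in smooth_pred }.

HB.instance Definition _ (R : realType) (M : manifold R) :=
  [isSub for @cf R M].
HB.instance Definition _ (R : realType) (M : manifold R) :=
  [Choice of Cinf M by <:].
HB.instance Definition _ (R : realType) (M : manifold R) :=
  GRing.SubChoice_isSubComPzRing.Build (M -> R) smooth_pred (Cinf M)
    smooth_subring.

Section CinfTheory.
Context {R : realType} {M : manifold R}.

Lemma cfP (f : Cinf M) : smooth_on setT f.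
Proof. exact/smooth_predP/cf_mem. Qed.

Definition mk_cinf (f : M -> R) (sf : smooth_on setT f) : Cinf M :=
  MkCinf (introT (smooth_predP f) sf).

Definition cst_cinf (k : R) : Cinf M := mk_cinf (smooth_cst setT k).

End CinfTheory.

Record trivialization (R : realType) (M : manifold R) (E : M -> lmodType R)
    (r : nat) := Triv {
  tdom : set M;
  tmap : forall x, E x -> 'rV[R]_r;
  tinv : forall x, 'rV[R]_r -> E x;
  tdom_open : open tdom;
  tmap_linear : forall x, tdom x -> linear (@tmap x);
  tmapK : forall x, tdom x -> cancel (@tmap x) (@tinv x);
  tinvK : forall x, tdom x -> cancel (@tinv x) (@tmap x) }.
Arguments tmap {R M E r} t x v.
Arguments tinv {R M E r} t x v.

Record vector_bundle (R : realType) (M : manifold R) := VectorBundle {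
  fibre :> M -> lmodType R;
  vb_rank : nat;
  trivs : set (trivialization fibre vb_rank);
  trivs_cover : forall x, exists2 t, trivs t & tdom t x;
  trivs_compat : forall t t', trivs t -> trivs t' -> forall i j : 'I_vb_rank,
    smooth_on (tdom t `&` tdom t')
      (fun x => tmap t' x (tinv t x (delta_mx 0 j)) 0 i) }.

Section Sections.
Context {R : realType} {M : manifold R}.

Definition smooth_section (E : vector_bundle M) (s : forall x, E x) : Prop :=
  forall t, trivs t -> forall i : 'I_(vb_rank E),
    smooth_on (tdom t) (fun x => tmap t x (s x) 0 i).

Record Gamma (E : vector_bundle M) := MkGamma {
  gval :> forall x, E x;
  gvalP : smooth_section gval }.

Lemma gammaE (E : vector_bundle M) (s s' : Gamma E) :
  (forall x, s x = s' x) -> s = s'.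
Proof.
case: s s' => [s ps] [s' ps'] /= e.
have {}e : s = s' by apply: functional_extensionality_dep.
by rewrite {}e in ps *; congr MkGamma; exact: Prop_irrelevance.
Qed.

HB.instance Definition _ (E : vector_bundle M) := gen_eqMixin (Gamma E).
HB.instance Definition _ (E : vector_bundle M) := gen_choiceMixin (Gamma E).

Section GammaModule.
Variable E : vector_bundle M.

Lemma smooth_section0 : smooth_section (fun x => 0 : E x).
Proof.
move=> t tt i; apply: (smooth_ext (tdom_open t) _ (smooth_cst _ 0)) => x tx.
have := tmap_linear tx (-1) 0 0; rewrite scaler0 addr0 scaleN1r addNr => ->.
by rewrite mxE.
Qed.

Lemma smooth_sectionD (s s' : Gamma E) : smooth_section (fun x => s x + s' x).
Proof.
move=> t tt i.
apply: (smooth_ext (tdom_open t) _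
  (smooth_add (tdom_open t) (gvalP s tt i) (gvalP s' tt i))) => x tx.
by have := tmap_linear tx 1 (s x) (s' x); rewrite !scale1r => ->; rewrite mxE.
Qed.

Lemma smooth_sectionZ (f : Cinf M) (s : Gamma E) :
  smooth_section (fun x => f x *: s x).
Proof.
move=> t tt i.
have sf : smooth_on (tdom t) f by apply: smooth_sub (cfP f).
apply: (smooth_ext (tdom_open t) _
  (smooth_mul (tdom_open t) sf (gvalP s tt i))) => x tx.
have /(_ (f x) (s x) 0) := tmap_linear tx; rewrite addr0 => ->.
have := tmap_linear tx (-1) 0 0; rewrite scaler0 addr0 scaleN1r addNr => ->.
by rewrite addr0 mxE.
Qed.

Lemma smooth_sectionN (s : Gamma E) : smooth_section (fun x => - s x).
Proof.
move=> t tt i; apply: (smooth_ext (tdom_open t) _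
  (smooth_opp (tdom_open t) (gvalP s tt i))) => x tx.
have /(_ (-1) (s x) 0) := tmap_linear tx; rewrite addr0 scaleN1r => ->.
have := tmap_linear tx (-1) 0 0; rewrite scaler0 addr0 scaleN1r addNr => ->.
by rewrite addr0 scaleN1r mxE.
Qed.

Definition gzero : Gamma E := MkGamma smooth_section0.
Definition gadd s s' : Gamma E := MkGamma (smooth_sectionD s s').
Definition gscale f s : Gamma E := MkGamma (smooth_sectionZ f s).
Definition gopp s : Gamma E := MkGamma (smooth_sectionN s).

Lemma gaddA : associative gadd.
Proof. by move=> s s' s''; apply: gammaE => x; exact: addrA. Qed.
Lemma gaddC : commutative gadd.
Proof. by move=> s s'; apply: gammaE => x; exact: addrC. Qed.
Lemma gadd0 : left_id gzero gadd.
Proof. by move=> s; apply: gammaE => x; exact: add0r. Qed.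
Lemma gaddN : left_inverse gzero gopp gadd.
Proof.
by move=> s; apply: gammaE => x /=; exact: addNr.
Qed.

HB.instance Definition _ :=
  GRing.isZmodule.Build (Gamma E) gaddA gaddC gadd0 gaddN.

Lemma gscaleA f g s : gscale f (gscale g s) = gscale (f * g) s.
Proof. by apply: gammaE => x /=; exact: scalerA. Qed.
Lemma gscale1 : left_id 1 gscale.
Proof. by move=> s; apply: gammaE => x; exact: scale1r. Qed.
Lemma gscaleDr : right_distributive gscale +%R.
Proof. by move=> f s s'; apply: gammaE => x; exact: scalerDr. Qed.
Lemma gscaleDl s : {morph gscale^~ s : f g / f + g}.
Proof. by move=> f g; apply: gammaE => x; exact: scalerDl. Qed.

HB.instance Definition _ := GRing.Zmodule_isLmodule.Build (Cinf M) (Gamma E)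
  gscaleA gscale1 gscaleDr gscaleDl.

End GammaModule.
End Sections.

Section Tensors.
Context {R : realType} {M : manifold R}.
Implicit Types A E F Q : vector_bundle M.

(* Vector bundle maps over the identity of M. A family of fibrewise linear
   maps is smooth iff it sends smooth sections to smooth sections; the
   smoothness of anchors and of forms is expressed in the same way. *)
Record bundle_map E F := BundleMap {
  bfib : forall x, E x -> F x;
  bfib_linear : forall x, linear (@bfib x);
  bfib_smooth : forall s : Gamma E, smooth_section (fun x => bfib (s x)) }.

Definition bmap E F (phi : bundle_map E F) (s : Gamma E) : Gamma F :=
  MkGamma (bfib_smooth phi s).
Coercion bmap : bundle_map >-> Funclass.

(* The tangent space at x, as the space of derivations at x. *)
Record tangent (x : M) := Tangent {
  tval :> Cinf M -> R;
  tval_linear : forall k f g, tval (cst_cinf k * f + g) = k * tval f + tval g;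
  tval_leibniz : forall f g, tval (f * g) = f x * tval g + g x * tval f }.

(* Vector bundle maps E -> TM. A vector field X is smooth iff X f is smooth for
   every smooth f. *)
Record anchor E := Anchor {
  afib : forall x, E x -> tangent x;
  afib_linear : forall x k (e e' : E x) f,
    afib (k *: e + e') f = k * afib e f + afib e' f;
  afib_smooth : forall (s : Gamma E) (f : Cinf M),
    smooth_on setT (fun x => afib (s x) f) }.

Definition anchor_act E (rho : anchor E) (s : Gamma E) (f : Cinf M) : Cinf M :=
  mk_cinf (afib_smooth rho s f).
Coercion anchor_act : anchor >-> Funclass.

(* Omega^2(A, Hom(E, F)) for a vector bundle A. *)
Record omega2 A E F := Omega2 {
  o2 : forall x, A x -> A x -> E x -> F x;
  o2_linear1 : forall x a' e, linear (fun a : A x => o2 a a' e);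
  o2_linear2 : forall x (a : A x) e, linear (fun a' => o2 a a' e);
  o2_linear3 : forall x (a a' : A x), linear (o2 a a');
  o2_alt : forall x (a : A x) e, o2 a a e = 0;
  o2_smooth : forall (a a' : Gamma A) (e : Gamma E),
    smooth_section (fun x => o2 (a x) (a' x) (e x)) }.

Definition o2map A E F (w : omega2 A E F) (a a' : Gamma A) (e : Gamma E) :
  Gamma F := MkGamma (o2_smooth w a a' e).
Coercion o2map : omega2 >-> Funclass.

(* Omega^3(Q, F). *)
Record omega3 Q F := Omega3 {
  o3 : forall x, Q x -> Q x -> Q x -> F x;
  o3_linear1 : forall x q2 q3, linear (fun q1 : Q x => o3 q1 q2 q3);
  o3_linear2 : forall x (q1 : Q x) q3, linear (fun q2 => o3 q1 q2 q3);
  o3_linear3 : forall x (q1 q2 : Q x), linear (o3 q1 q2);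
  o3_alt12 : forall x (q q' : Q x), o3 q q q' = 0;
  o3_alt23 : forall x (q q' : Q x), o3 q q' q' = 0;
  o3_smooth : forall q1 q2 q3 : Gamma Q,
    smooth_section (fun x => o3 (q1 x) (q2 x) (q3 x)) }.

Definition o3map Q F (w : omega3 Q F) (q1 q2 q3 : Gamma Q) : Gamma F :=
  MkGamma (o3_smooth w q1 q2 q3).
Coercion o3map : omega3 >-> Funclass.

End Tensors.

Section DirectSum.
Context {R : realType} {M : manifold R}.
Variables A B : vector_bundle M.

Definition dsum_fibre (x : M) : lmodType R := (A x * B x)%type.

Section Dtriv.
Variables (t : trivialization A (vb_rank A)) (u : trivialization B (vb_rank B)).

Definition dtmap x (v : dsum_fibre x) : 'rV[R]_(vb_rank A + vb_rank B) :=
  row_mx (tmap t x v.1) (tmap u x v.2).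
Definition dtinv x (w : 'rV[R]_(vb_rank A + vb_rank B)) : dsum_fibre x :=
  (tinv t x (lsubmx w), tinv u x (rsubmx w)).

Lemma dtmap_linear x : (tdom t `&` tdom u) x -> linear (@dtmap x).
Proof.
by move=> [tx ux] k v w; rewrite /dtmap /= (tmap_linear tx) (tmap_linear ux)
  scale_row_mx add_row_mx.
Qed.

Lemma dtmapK x : (tdom t `&` tdom u) x -> cancel (@dtmap x) (@dtinv x).
Proof.
move=> [tx ux] [a b].
by rewrite /dtinv /dtmap row_mxKl row_mxKr /= (tmapK tx) (tmapK ux).
Qed.

Lemma dtinvK x : (tdom t `&` tdom u) x -> cancel (@dtinv x) (@dtmap x).
Proof.
move=> [tx ux] w.
by rewrite /dtinv /dtmap /= (tinvK tx) (tinvK ux) hsubmxK.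
Qed.

Definition dtriv : trivialization dsum_fibre (vb_rank A + vb_rank B) :=
  Triv (openI (tdom_open t) (tdom_open u)) dtmap_linear dtmapK dtinvK.
End Dtriv.

Definition dsum_trivs :
    set (trivialization dsum_fibre (vb_rank A + vb_rank B)) :=
  [set w | exists t u, [/\ trivs t, trivs u & w = dtriv t u]].

Lemma dsum_cover x : exists2 w, dsum_trivs w & tdom w x.
Proof.
have [t tt tx] := trivs_cover A x; have [u uu ux] := trivs_cover B x.
by exists (dtriv t u); [exists t, u|split].
Qed.

Lemma lin0 (V : lmodType R) (W : lmodType R) (f : V -> W) : linear f -> f 0 = 0.
Proof.
by move=> /(_ (-1) 0 0); rewrite scaler0 addr0 scaleN1r addNr.
Qed.

Lemma tinv_linear0 (E : vector_bundle M) (t : trivialization E (vb_rank E)) x :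
  tdom t x -> tinv t x 0 = 0.
Proof.
by move=> tx; rewrite -(lin0 (tmap_linear tx)) (tmapK tx).
Qed.

Lemma dsum_compat w w' : dsum_trivs w -> dsum_trivs w' ->
  forall i j : 'I_(vb_rank A + vb_rank B),
  smooth_on (tdom w `&` tdom w')
    (fun x => tmap w' x (tinv w x (delta_mx 0 j)) 0 i).
Proof.
move=> [t [u [tt uu ->]]] [t' [u' [tt' uu' ->]]] i j /=.
have oW : open ((tdom t `&` tdom u) `&` (tdom t' `&` tdom u')).
  by apply: openI; apply: openI; exact: tdom_open.
have z0 := smooth_cst ((tdom t `&` tdom u) `&` (tdom t' `&` tdom u')) (0 : R).
rewrite -(fintype.splitK i) -(fintype.splitK j) /dtmap /dtinv.
case: (fintype.split i) => i'; case: (fintype.split j) => j' /=.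
- apply: (smooth_ext oW _ (smooth_sub _ (trivs_compat tt tt' i' j'))).
    move=> x [[tx ux] [tx' ux']]; rewrite row_mxEl.
    congr (tmap t' x (tinv t x _) 0 i').
    by apply/rowP => k; rewrite !mxE /= (inj_eq (@lshift_inj _ _)).
  by move=> x [[? _] [? _]].
- apply: (smooth_ext oW _ z0) => x [[tx ux] [tx' ux']]; rewrite row_mxEl.
  have -> : lsubmx
      (delta_mx 0 (rshift (vb_rank A) j') : 'rV[R]_(vb_rank A + vb_rank B)) = 0.
    by apply/rowP => k; rewrite !mxE /= eq_lrshift ?andbF.
  by rewrite (tinv_linear0 tx) (lin0 (tmap_linear tx')) mxE.
- apply: (smooth_ext oW _ z0) => x [[tx ux] [tx' ux']]; rewrite row_mxEr.
  have -> : rsubmx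
      (delta_mx 0 (lshift (vb_rank B) j') : 'rV[R]_(vb_rank A + vb_rank B)) = 0.
    by apply/rowP => k; rewrite !mxE /= eq_rlshift ?andbF.
  by rewrite (tinv_linear0 ux) (lin0 (tmap_linear ux')) mxE.
- apply: (smooth_ext oW _ (smooth_sub _ (trivs_compat uu uu' i' j'))).
    move=> x [[tx ux] [tx' ux']]; rewrite row_mxEr.
    congr (tmap u' x (tinv u x _) 0 i').
    by apply/rowP => k; rewrite !mxE /= (inj_eq (@rshift_inj _ _)).
  by move=> x [[_ ?] [_ ?]].
Qed.

Definition dsum : vector_bundle M := VectorBundle dsum_cover dsum_compat.

Lemma gpair_smooth (a : Gamma A) (b : Gamma B) :
  @smooth_section _ _ dsum (fun x => (a x, b x) : dsum_fibre x).
Proof.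
move=> _ [t [u [tt uu ->]]] i /=.
have oW : open (tdom t `&` tdom u) by apply: openI; exact: tdom_open.
rewrite /dtmap /= -(fintype.splitK i); case: (fintype.split i) => i' /=.
- apply: (smooth_ext oW _ (smooth_sub _ (gvalP a tt i'))).
    by move=> x _; rewrite row_mxEl.
  by move=> x [].
- apply: (smooth_ext oW _ (smooth_sub _ (gvalP b uu i'))).
    by move=> x _; rewrite row_mxEr.
  by move=> x [].
Qed.

Definition gpair (a : Gamma A) (b : Gamma B) : Gamma dsum :=
  MkGamma (gpair_smooth a b).

Lemma prA_linear x : linear (fun v : dsum x => v.1).
Proof. by []. Qed.
Lemma prB_linear x : linear (fun v : dsum x => v.2).
Proof. by []. Qed.

Lemma prA_smooth (q : Gamma dsum) : @smooth_section _ _ A (fun x => (q x).1).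
Proof.
move=> t tt i; apply: smooth_local => x tx.
have [u uu ux] := trivs_cover B x; exists (tdom u); split=> //.
  exact: tdom_open.
have dt : trivs (dtriv t u : trivialization dsum (vb_rank dsum)) by exists t, u.
apply: (smooth_ext _ _ (gvalP q dt (lshift (vb_rank B) i))).
  by apply: openI; exact: tdom_open.
by move=> y _; rewrite /= /dtmap row_mxEl.
Qed.

Lemma prB_smooth (q : Gamma dsum) : @smooth_section _ _ B (fun x => (q x).2).
Proof.
move=> u uu i; apply: smooth_local => x ux.
have [t tt tx] := trivs_cover A x; exists (tdom t); split=> //.
  exact: tdom_open.
have dt : trivs (dtriv t u : trivialization dsum (vb_rank dsum)) by exists t, u.
apply: (smooth_ext _ _ (smooth_sub _ (gvalP q dt (rshift (vb_rank A) i)))).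
- by apply: openI; exact: tdom_open.
- by move=> y _; rewrite /= /dtmap row_mxEr.
- by move=> y [? ?]; split.
Qed.

Definition prA : bundle_map dsum A := BundleMap prA_linear prA_smooth.
Definition prB : bundle_map dsum B := BundleMap prB_linear prB_smooth.

Lemma inA_linear x : linear (fun a : A x => (a, 0) : dsum x).
Proof.
move=> k a a'.
have -> : k *: ((a, 0) : dsum x) + (a', 0) = (k *: a + a', k *: 0 + 0) by [].
by rewrite scaler0 addr0.
Qed.
Lemma inB_linear x : linear (fun b : B x => (0, b) : dsum x).
Proof.
move=> k b b'.
have -> : k *: ((0, b) : dsum x) + (0, b') = (k *: 0 + 0, k *: b + b') by [].
by rewrite scaler0 addr0.
Qed.

Definition inA : bundle_map A dsum :=
  @BundleMap _ _ A dsum _ inA_linear (fun a => gpair_smooth a 0).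
Definition inB : bundle_map B dsum :=
  @BundleMap _ _ B dsum _ inB_linear (fun b => gpair_smooth 0 b).

End DirectSum.

(* dnabk is the Koszul formula for the covariant exterior derivative of a
   k-form. *)
Section Koszul.
Context {X : Type} {V : zmodType}.
Variables (nab : X -> V -> V) (br : X -> X -> X).

Definition curv x y (v : V) : V :=
  nab x (nab y v) - nab y (nab x v) - nab (br x y) v.

Definition dnab1 (w : X -> V) x y : V :=
  nab x (w y) - nab y (w x) - w (br x y).

Definition dnab2 (w : X -> X -> V) x y z : V :=
  nab x (w y z) - nab y (w x z) + nab z (w x y)
  - w (br x y) z + w (br x z) y - w (br y z) x.

Definition dnab3 (w : X -> X -> X -> V) x y z t : V :=
  nab x (w y z t) - nab y (w x z t) + nab z (w x y t) - nab t (w x y z)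
  - w (br x y) z t + w (br x z) y t - w (br x t) y z
  - w (br y z) x t + w (br y t) x z - w (br z t) x y.
End Koszul.

(* The connection induced on Hom(E1, E0), on an element seen as a map
   Gamma E1 -> Gamma E0. *)
Definition nab_hom (X : Type) (V0 V1 : zmodType)
    (nab0 : X -> V0 -> V0) (nab1 : X -> V1 -> V1) (x : X) (h : V1 -> V0) :
    V1 -> V0 :=
  fun e => nab0 x (h e) - h (nab1 x e).

(* The connection induced on /\^2 E^* (x) F, on an element seen as a map
   Gamma E -> Gamma E -> Gamma F. *)
Definition nab_wedge2 (X : Type) (V W : zmodType)
    (nabE : X -> V -> V) (nabF : X -> W -> W) (x : X) (h : V -> V -> W) :
    V -> V -> W :=
  fun e e' => nabF x (h e e') - h (nabE x e) e' - h e (nabE x e').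

Section Structures.
Context {R : realType} {M : manifold R}.
Implicit Types A B C E F Q : vector_bundle M.

Record is_connection Q E (rho : anchor Q) (nab : Gamma Q -> Gamma E -> Gamma E)
    : Prop := IsConnection {
  nab_linear : forall f q q' e, nab (f *: q + q') e = f *: nab q e + nab q' e;
  nab_add : forall q e e', nab q (e + e') = nab q e + nab q e';
  nab_leibniz : forall q f e, nab q (f *: e) = f *: nab q e + rho q f *: e }.

Record bracket_data Q := BracketData {
  rho : anchor Q;
  brk : Gamma Q -> Gamma Q -> Gamma Q }.

(* R-linearity of nab q and of brk q follows from additivity and the Leibniz
   rule, since derivations kill constants. *)
Record is_dull Q (D : bracket_data Q) : Prop := IsDull {
  brk_add : forall q q1 q2, brk D q (q1 + q2) = brk D q q1 + brk D q q2;
  brk_skew : forall q1 q2, brk D q1 q2 = - brk D q2 q1;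
  brk_leibniz : forall q1 f q2,
    brk D q1 (f *: q2) = f *: brk D q1 q2 + rho D q1 f *: q2;
  brk_anchor : forall q1 q2 f,
    rho D (brk D q1 q2) f = rho D q1 (rho D q2 f) - rho D q2 (rho D q1 f) }.

Definition jac Q (D : bracket_data Q) q1 q2 q3 : Gamma Q :=
  brk D (brk D q1 q2) q3 + brk D q2 (brk D q1 q3) - brk D q1 (brk D q2 q3).

Record is_lie_algebroid Q (D : bracket_data Q) : Prop := IsLieAlgebroid {
  lie_dull : is_dull D;
  lie_jacobi : forall q1 q2 q3, jac D q1 q2 q3 = 0 }.

Record rep2_data A E0 E1 := Rep2Data {
  rdiff : bundle_map E0 E1;
  rnab0 : Gamma A -> Gamma E0 -> Gamma E0;
  rnab1 : Gamma A -> Gamma E1 -> Gamma E1;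
  rcurv : omega2 A E1 E0 }.

Record is_rep2 A E0 E1 (L : bracket_data A) (D : rep2_data A E0 E1) : Prop :=
IsRep2 {
  rep2_nab0 : is_connection (rho L) (rnab0 D);
  rep2_nab1 : is_connection (rho L) (rnab1 D);
  rep2_diff : forall a e, rdiff D (rnab0 D a e) = rnab1 D a (rdiff D e);
  rep2_curv0 : forall a1 a2 e,
    curv (rnab0 D) (brk L) a1 a2 e = rcurv D a1 a2 (rdiff D e);
  rep2_curv1 : forall a1 a2 e,
    curv (rnab1 D) (brk L) a1 a2 e = rdiff D (rcurv D a1 a2 e);
  rep2_bianchi : forall a1 a2 a3 e,
    dnab2 (nab_hom (rnab0 D) (rnab1 D)) (brk L) (rcurv D) a1 a2 a3 e = 0 }.

(* Split Lie 2-algebroids Q (+) C, where C is the bundle denoted B^* in the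
   definition and sl_nab is the connection on C dual to the one on B = C^*. *)
Record split_lie2_data Q C := SplitLie2Data {
  sl_bracket :> bracket_data Q;
  sl_l1 : bundle_map C Q;
  sl_nab : Gamma Q -> Gamma C -> Gamma C;
  sl_l3 : omega3 Q C }.

Record is_split_lie2 Q C (S : split_lie2_data Q C) : Prop := IsSplitLie2 {
  sl_dull : is_dull S;
  sl_connection : is_connection (rho S) (sl_nab S);
  sl_skew : forall c1 c2,
    sl_nab S (sl_l1 S c1) c2 + sl_nab S (sl_l1 S c2) c1 = 0;
  sl_equivariant : forall q c, brk S q (sl_l1 S c) = sl_l1 S (sl_nab S q c);
  sl_jacobi : forall q1 q2 q3, jac S q1 q2 q3 = - sl_l1 S (sl_l3 S q1 q2 q3);
  sl_curv : forall q1 q2 c,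
    curv (sl_nab S) (brk S) q1 q2 c = sl_l3 S q1 q2 (sl_l1 S c);
  sl_closed : forall q1 q2 q3 q4,
    dnab3 (sl_nab S) (brk S) (sl_l3 S) q1 q2 q3 q4 = 0 }.

(* Equality of the structure maps, compared on sections and smooth functions
   (which determine anchors, bundle maps and forms). *)
Record split_lie2_eq Q C (S T : split_lie2_data Q C) : Prop := SplitLie2Eq {
  eq_rho : forall q f, rho S q f = rho T q f;
  eq_brk : forall q1 q2, brk S q1 q2 = brk T q1 q2;
  eq_l1 : forall c, sl_l1 S c = sl_l1 T c;
  eq_nab : forall q c, sl_nab S q c = sl_nab T q c;
  eq_l3 : forall q1 q2 q3, sl_l3 S q1 q2 q3 = sl_l3 T q1 q2 q3 }.

End Structures.

Section MatchedPair.
Context {R : realType} {M : manifold R} {A B C : vector_bundle M}.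
Variables (LA : bracket_data A) (LB : bracket_data B).
Variables (DA : rep2_data A C B) (DB : rep2_data B C A).

Local Notation brA := (brk LA).
Local Notation brB := (brk LB).
Local Notation dB := (rdiff DA).
Local Notation nAC := (rnab0 DA).
Local Notation nAB := (rnab1 DA).
Local Notation RAB := (rcurv DA).
Local Notation dA := (rdiff DB).
Local Notation nBC := (rnab0 DB).
Local Notation nBA := (rnab1 DB).
Local Notation RBA := (rcurv DB).

Record is_matched_pair : Prop := IsMatchedPair {
  mp1 : forall c1 c2,
    nAC (dA c1) c2 - nBC (dB c2) c1 = - nAC (dA c2) c1 + nBC (dB c1) c2;
  mp2 : forall a c, brA a (dA c) = dA (nAC a c) - nBA (dB c) a;
  mp3 : forall b c, brB b (dB c) = dB (nBC b c) - nAB (dA c) b;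
  mp4 : forall a b c,
    nBC b (nAC a c) - nAC a (nBC b c) - nAC (nBA b a) c + nBC (nAB a b) c
    = RBA b (dB c) a - RAB a (dA c) b;
  mp5 : forall a1 a2 b,
    dA (RAB a1 a2 b) = - nBA b (brA a1 a2) + brA (nBA b a1) a2
      + brA a1 (nBA b a2) + nBA (nAB a2 b) a1 - nBA (nAB a1 b) a2;
  mp6 : forall b1 b2 a,
    dB (RBA b1 b2 a) = - nAB a (brB b1 b2) + brB (nAB a b1) b2
      + brB b1 (nAB a b2) + nAB (nBA b2 a) b1 - nAB (nBA b1 a) b2;
  mp7 : forall a1 a2 b1 b2,
    dnab1 (nab_wedge2 nAB nAC) brA (fun a b b' => RBA b b' a) a1 a2 b1 b2
    = dnab1 (nab_wedge2 nBA nBC) brB (fun b a a' => RAB a a' b) b1 b2 a1 a2 }.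

Local Notation Q := (dsum A B).

Lemma tangentD_linear x (u v : tangent x) k (f g : Cinf M) :
  u (cst_cinf k * f + g) + v (cst_cinf k * f + g)
  = k * (u f + v f) + (u g + v g).
Proof. by rewrite !tval_linear mulrDr addrACA. Qed.

Lemma tangentD_leibniz x (u v : tangent x) (f g : Cinf M) :
  u (f * g) + v (f * g) = f x * (u g + v g) + g x * (u f + v f).
Proof. by rewrite !tval_leibniz !mulrDr addrACA. Qed.

Definition tangentD x (u v : tangent x) : tangent x :=
  Tangent (tangentD_linear u v) (tangentD_leibniz u v).

Definition double_afib x (q : Q x) : tangent x :=
  tangentD (afib (rho LA) q.1) (afib (rho LB) q.2).

Lemma double_afib_linear x k (q q' : Q x) f :
  double_afib (k *: q + q') f = k * double_afib q f + double_afib q' f.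
Proof. by rewrite /= !afib_linear mulrDr addrACA. Qed.

Lemma double_afib_smooth (q : Gamma Q) (f : Cinf M) :
  smooth_on setT (fun x => double_afib (q x) f).
Proof. exact: cfP (rho LA (prA A B q) f + rho LB (prB A B q) f). Qed.

Definition double_anchor : anchor Q :=
  Anchor double_afib_linear double_afib_smooth.

Definition double_brk (q q' : Gamma Q) : Gamma Q :=
  let a := prA A B q in let b := prB A B q in
  let a' := prA A B q' in let b' := prB A B q' in
  gpair (brA a a' + nBA b a' - nBA b' a) (brB b b' + nAB a b' - nAB a' b).

Definition double_l1_fib x (c : C x) : Q x := (- bfib dA c, bfib dB c).

Lemma double_l1_linear x : linear (@double_l1_fib x).
Proof.
move=> k c c'; rewrite /double_l1_fib !bfib_linear.
have -> : k *: ((- bfib dA c, bfib dB c) : Q x) + (- bfib dA c', bfib dB c')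
  = (k *: (- bfib dA c) - bfib dA c', k *: bfib dB c + bfib dB c') by [].
by rewrite opprD scalerN.
Qed.

Lemma double_l1_smooth (c : Gamma C) :
  @smooth_section _ _ Q (fun x => double_l1_fib (c x)).
Proof. exact: gvalP (gpair (- dA c) (dB c)). Qed.

Definition double_l1 : bundle_map C Q :=
  BundleMap double_l1_linear double_l1_smooth.

Definition double_nab (q : Gamma Q) (c : Gamma C) : Gamma C :=
  nAC (prA A B q) c + nBC (prB A B q) c.

Definition double_o3 x (q1 q2 q3 : Q x) : C x :=
  o2 RAB q1.1 q2.1 q3.2 + o2 RAB q2.1 q3.1 q1.2 + o2 RAB q3.1 q1.1 q2.2
  - o2 RBA q1.2 q2.2 q3.1 - o2 RBA q2.2 q3.2 q1.1 - o2 RBA q3.2 q1.2 q2.1.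

Lemma double_o3_cycle x (q1 q2 q3 : Q x) :
  double_o3 q1 q2 q3 = double_o3 q2 q3 q1.
Proof.
have cyc (V : zmodType) (X Y Z U W T : V) :
    X + Y + Z - U - W - T = Y + Z + X - W - T - U.
  rewrite -!(addrA _ (- _)) -!opprD; congr (_ - _).
    by rewrite -addrA addrC.
  by rewrite [LHS]addrC addrA.
exact: cyc.
Qed.

Lemma o2_skew (A' E F : vector_bundle M) (w : omega2 A' E F) x
    (a a' : A' x) (e : E x) :
  o2 w a a' e + o2 w a' a e = 0.
Proof.
have := o2_alt w (a + a') e.
have D1 (u v z : A' x) : o2 w (u + v) z e = o2 w u z e + o2 w v z e.
  by have := @o2_linear1 _ _ _ _ _ w x z e 1 u v; rewrite !scale1r.
have D2 (u v z : A' x) : o2 w z (u + v) e = o2 w z u e + o2 w z v e.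
  by have := @o2_linear2 _ _ _ _ _ w x z e 1 u v; rewrite !scale1r.
by rewrite D1 !D2 !o2_alt add0r addr0.
Qed.

Lemma double_o3_linear1 x (q2 q3 : Q x) :
  linear (fun q1 => double_o3 q1 q2 q3).
Proof.
have lD (V W : lmodType R) (f g : V -> W) : linear f -> linear g ->
    linear (fun v => f v + g v).
  by move=> lf lg k u v; rewrite lf lg scalerDr addrACA.
have lN (V W : lmodType R) (f : V -> W) : linear f -> linear (fun v => - f v).
  by move=> lf k u v; rewrite lf opprD scalerN.
have l1 (f : A x -> C x) : linear f -> linear (fun q : Q x => f q.1).
  by move=> lf k u v; exact: lf.
have l2 (f : B x -> C x) : linear f -> linear (fun q : Q x => f q.2).
  by move=> lf k u v; exact: lf.
rewrite /double_o3; do ![apply: (@lD) | apply: (@lN)].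
- exact: (l1 _ (@o2_linear1 _ _ _ _ _ RAB x _ _)).
- exact: (l2 _ (@o2_linear3 _ _ _ _ _ RAB x _ _)).
- exact: (l1 _ (@o2_linear2 _ _ _ _ _ RAB x _ _)).
- exact: (l2 _ (@o2_linear1 _ _ _ _ _ RBA x _ _)).
- exact: (l1 _ (@o2_linear3 _ _ _ _ _ RBA x _ _)).
- exact: (l2 _ (@o2_linear2 _ _ _ _ _ RBA x _ _)).
Qed.

Lemma double_o3_linear2 x (q1 q3 : Q x) :
  linear (fun q2 => double_o3 q1 q2 q3).
Proof.
move=> k u v; rewrite !(double_o3_cycle q1); exact: double_o3_linear1.
Qed.

Lemma double_o3_linear3 x (q1 q2 : Q x) : linear (double_o3 q1 q2).
Proof.
move=> k u v; rewrite -!(double_o3_cycle _ q1 q2); exact: double_o3_linear1.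
Qed.

Lemma double_o3_alt12 x (q q' : Q x) : double_o3 q q q' = 0.
Proof.
rewrite /double_o3 !o2_alt add0r o2_skew subr0 sub0r.
by rewrite -opprD o2_skew oppr0.
Qed.

Lemma double_o3_alt23 x (q q' : Q x) : double_o3 q q' q' = 0.
Proof. by rewrite double_o3_cycle double_o3_alt12. Qed.

Lemma double_o3_smooth (q1 q2 q3 : Gamma Q) :
  smooth_section (fun x => double_o3 (q1 x) (q2 x) (q3 x)).
Proof.
pose a := prA A B; pose b := prB A B.
exact: (gvalP (RAB (a q1) (a q2) (b q3) + RAB (a q2) (a q3) (b q1)
  + RAB (a q3) (a q1) (b q2) - RBA (b q1) (b q2) (a q3)
  - RBA (b q2) (b q3) (a q1) - RBA (b q3) (b q1) (a q2))).
Qed.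

Definition double_l3 : omega3 Q C :=
  Omega3 double_o3_linear1 double_o3_linear2 double_o3_linear3
    double_o3_alt12 double_o3_alt23 double_o3_smooth.

Definition bicrossproduct : split_lie2_data Q C :=
  SplitLie2Data (BracketData double_anchor double_brk)
    double_l1 double_nab double_l3.

End MatchedPair.

Section Components.
Context {R : realType} {M : manifold R}.

Lemma anchor_comp_linear (E Q : vector_bundle M) (r : anchor Q)
    (phi : bundle_map E Q) x k (e e' : E x) f :
  afib r (bfib phi (k *: e + e')) f
  = k * afib r (bfib phi e) f + afib r (bfib phi e') f.
Proof. by rewrite bfib_linear afib_linear. Qed.

Definition anchor_comp (E Q : vector_bundle M) (r : anchor Q)
    (phi : bundle_map E Q) : anchor E :=
  Anchor (anchor_comp_linear r phi)
    (fun s f => afib_smooth r (phi s) f).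

Definition bundle_map_comp (E F G : vector_bundle M) (psi : bundle_map F G)
    (phi : bundle_map E F) : bundle_map E G.
Proof.
exists (fun x v => bfib psi (bfib phi v)).
- by move=> x k u v; rewrite !bfib_linear.
- by move=> s; exact: bfib_smooth psi (phi s).
Defined.

Definition bundle_map_opp (E F : vector_bundle M) (phi : bundle_map E F) :
  bundle_map E F.
Proof.
exists (fun x v => - bfib phi v).
- by move=> x k u v; rewrite bfib_linear opprD scalerN.
- by move=> s; exact: gvalP (- phi s).
Defined.

(* (e1, e2, f) |-> w (i e1) (i e2) (j f) *)
Definition omega3_pull (E F G Q : vector_bundle M) (w : omega3 Q G)
    (i : bundle_map E Q) (j : bundle_map F Q) : omega2 E F G.
Proof.
exists (fun x u v e => o3 w (bfib i u) (bfib i v) (bfib j e)).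
- by move=> x a' e k u v; rewrite bfib_linear o3_linear1.
- by move=> x a e k u v; rewrite bfib_linear o3_linear2.
- by move=> x a a' k u v; rewrite bfib_linear o3_linear3.
- by move=> x a e; rewrite o3_alt12.
- by move=> a a' e; exact: o3_smooth w (i a) (i a') (j e).
Defined.

Definition omega2_opp (A E F : vector_bundle M) (w : omega2 A E F) :
  omega2 A E F.
Proof.
exists (fun x a a' e => - o2 w a a' e).
- by move=> x a' e k u v; rewrite o2_linear1 opprD scalerN.
- by move=> x a e k u v; rewrite o2_linear2 opprD scalerN.
- by move=> x a a' k u v; rewrite o2_linear3 opprD scalerN.
- by move=> x a e; rewrite o2_alt oppr0.
- by move=> a a' e; exact: gvalP (- w a a' e).
Defined.

Context {A B C : vector_bundle M}.
Variable S : split_lie2_data (dsum A B) C.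

Local Notation iA := (inA A B).
Local Notation iB := (inB A B).
Local Notation pA := (prA A B).
Local Notation pB := (prB A B).

Definition comp_lieA (brA : Gamma A -> Gamma A -> Gamma A) : bracket_data A :=
  BracketData (anchor_comp (rho S) iA) brA.

Definition comp_lieB (brB : Gamma B -> Gamma B -> Gamma B) : bracket_data B :=
  BracketData (anchor_comp (rho S) iB) brB.

Definition comp_rep2A : rep2_data A C B := {|
  rdiff := bundle_map_comp pB (sl_l1 S);
  rnab0 := fun a c => sl_nab S (iA a) c;
  rnab1 := fun a b => pB (brk S (iA a) (iB b));
  rcurv := omega3_pull (sl_l3 S) iA iB |}.

Definition comp_rep2B : rep2_data B C A := {|
  rdiff := bundle_map_opp (bundle_map_comp pA (sl_l1 S));
  rnab0 := fun b c => sl_nab S (iB b) c;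
  rnab1 := fun b a => pA (brk S (iB b) (iA a));
  rcurv := omega2_opp (omega3_pull (sl_l3 S) iB iA) |}.

End Components.

(* Main.v *)
(* Apart from the Leibniz rules, the axioms of a split Lie 2-algebroid are the
   vanishing of expressions that are additive and alternating in the sections
   of Q = A (+) B. It is therefore enough to test them on sections of A and of
   B, listed with those of A first, and on such arguments the axioms of the
   double are, one by one, the axioms of the Lie algebroids A and B, of the two
   2-representations and of the matched pair. This settles both directions,
   since in (b) conditions 1 and 2 force the given structure to be the double
   of its components.

   What remains for (a) is that the anchor of the double preserves brackets,
   i.e. that h = [rho_B b, rho_A a] f - rho_A (nabla_b a) f
   + rho_B (nabla_a b) f vanishes. Replacing a section by a multiple in (5) and
   (6) shows that h annihilates all sections of A and of B; each term of h is
   the derivative of a function along such a section, so h^2 = 0 and h = 0. *)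
Require Import Defs.
From HB Require Import structures.
From mathcomp Require Import all_boot all_order all_algebra.
From mathcomp Require Import boolp classical_sets functions reals.
From mathcomp Require Import topology normedtype derive.

Set Implicit Arguments.
Unset Strict Implicit.
Unset Printing Implicit Defensive.

Import GRing.Theory.
Local Open Scope ring_scope.

(** * A decision procedure for abelian groups *)

Inductive zexpr := ZVar of nat | ZZero | ZAdd of zexpr & zexpr | ZOpp of zexpr.

Fixpoint zeval (V : zmodType) (env : seq V) (e : zexpr) : V :=
  match e with
  | ZVar n => nth 0 env n
  | ZZero => 0
  | ZAdd e1 e2 => zeval env e1 + zeval env e2
  | ZOpp e1 => - zeval env e1
  end.

Fixpoint zcoef (i : nat) (e : zexpr) : int :=
  match e with
  | ZVar n => (i == n)%:Z
  | ZZero => 0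
  | ZAdd e1 e2 => zcoef i e1 + zcoef i e2
  | ZOpp e1 => - zcoef i e1
  end.

(** An index beyond the environment evaluates to the default [0] of [nth] and contributes no
    summand, so the formula holds for every expression. *)
Lemma zevalE (V : zmodType) (env : seq V) e :
  zeval env e = \sum_(i < size env) env`_i *~ zcoef i e.
Proof.
elim: e => [n||e1 IH1 e2 IH2|e1 IH1] /=.
- have [ltn|len] := ltnP n (size env).
    rewrite (bigD1 (Ordinal ltn)) //= eqxx big1 ?addr0 // => i.
    by rewrite -val_eqE => /negPf /= ->.
  rewrite nth_default // big1 // => i _.
  by have /ltn_eqF -> : (i < n)%N by exact: leq_trans (ltn_ord i) len.
- by rewrite big1.
- by rewrite IH1 IH2 -big_split /=; apply: eq_bigr => i _; rewrite mulrzDr.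
- by rewrite IH1 -sumrN; apply: eq_bigr => i _; rewrite mulrNz.
Qed.

(** Soundness of the reflection: the premise is a closed comparison of integer coefficients, decided
    by computation whatever the group is. *)
Lemma zeval_eq (V : zmodType) (env : seq V) e1 e2 :
  all (fun i => zcoef i e1 == zcoef i e2) (iota 0 (size env)) ->
  zeval env e1 = zeval env e2.
Proof.
move=> /allP h; rewrite !zevalE; apply: eq_bigr => i _.
by rewrite (eqP (h i _)) // mem_iota /=.
Qed.

(* Atoms are compared up to conversion: the same section may occur with
   different canonical instances. *)
Ltac zmod_vars e l :=
  lazymatch e with
  | @GRing.add _ ?x ?y => let l1 := zmod_vars x l in zmod_vars y l1
  | @GRing.opp _ ?x => zmod_vars x l
  | @GRing.zero _ => l
  | _ => let rec go m :=
           lazymatch m with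
           | nil => constr:(e :: l)
           | ?h :: ?m' =>
               match goal with
               | _ => let _ := match goal with _ => unify e h end in l
               | _ => go m'
               end
           end in go l
  end.

(** The inner [match goal] runs [unify] while the tactic is returning a term; if it fails, the outer
    match moves on to the next atom. *)
Ltac zmod_index e l :=
  lazymatch l with
  | ?h :: ?l' =>
      match goal with
      | _ => let _ := match goal with _ => unify e h end in constr:(0%N)
      | _ => let n := zmod_index e l' in constr:(S n)
      end
  end.

Ltac zmod_reify e l :=
  lazymatch e with
  | @GRing.add _ ?x ?y =>
      let u := zmod_reify x l in let v := zmod_reify y l in constr:(ZAdd u v)
  | @GRing.opp _ ?x => let u := zmod_reify x l in constr:(ZOpp u)
  | @GRing.zero _ => constr:(ZZero)
  | _ => let n := zmod_index e l in constr:(ZVar n)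
  end.

(* Decides equalities that hold in every abelian group. *)
Ltac zmod :=
  lazymatch goal with
  | |- @eq ?T ?x ?y =>
      let l0 := constr:(@nil T) in
      let l1 := zmod_vars x l0 in
      let l := zmod_vars y l1 in
      let u := zmod_reify x l in
      let v := zmod_reify y l in
      refine (@zeval_eq _ l u v _); vm_compute; reflexivity
  end.

(** Derives an equation from another one with the same difference of sides; the second premise is
    then a pure group identity, left to [zmod]. *)
Lemma eq_by_diff (V : zmodType) (x y u v : V) : u = v -> x - y = u - v -> x = y.
Proof. by move=> -> /eqP; rewrite subrr subr_eq0 => /eqP. Qed.

(** * Additive and alternating maps *)

Section AdditiveMaps.
Context {U V : zmodType}.
Implicit Types f : U -> V.

Lemma morphD0 f : {morph f : x y / x + y} -> f 0 = 0.
Proof. by move=> fD; apply: (@addrI _ (f 0)); rewrite -fD !addr0. Qed.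

Lemma morphDN f : {morph f : x y / x + y} -> {morph f : x / - x}.
Proof.
move=> fD x; apply: (@addrI _ (f x)).
by rewrite -fD !subrr; apply: morphD0.
Qed.

(** Polarization: expand [f (x + y) (x + y) = 0]. *)
Lemma skew_of_alt (f : U -> U -> V) :
  (forall y, {morph f^~ y : x x' / x + x'}) ->
  (forall x, {morph f x : y y' / y + y'}) ->
  (forall x, f x x = 0) -> forall x y, f x y = - f y x.
Proof.
move=> fDl fDr f0 x y; apply/eqP; rewrite -addr_eq0; apply/eqP.
by have := f0 (x + y); rewrite fDr !fDl !f0 addr0 add0r addrC.
Qed.

(** Skew-symmetry carries additivity from the first slot to the second, so the lemmas below ask for
    it in the first slot only. *)
Lemma skew_addr (f : U -> U -> V) :
  (forall y, {morph f^~ y : x x' / x + x'}) ->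
  (forall x y, f x y = - f y x) -> forall x, {morph f x : y y' / y + y'}.
Proof. by move=> fD fS x y y'; rewrite fS fD opprD -!fS. Qed.

End AdditiveMaps.

Section Alternation.
Context {A B Q V : zmodType} (iA : A -> Q) (iB : B -> Q).
Hypothesis Q_split : forall q, exists a b, q = iA a + iB b.

Lemma additive_eq0 (T : Q -> V) : {morph T : x y / x + y} ->
  (forall a, T (iA a) = 0) -> (forall b, T (iB b) = 0) -> forall q, T q = 0.
Proof.
by move=> TD TA TB q; have [a [b ->]] := Q_split q; rewrite TD TA TB addr0.
Qed.

Lemma alternating2_eq0 (T : Q -> Q -> V) :
  (forall y, {morph T^~ y : x x' / x + x'}) ->
  (forall x y, T x y = - T y x) ->
  (forall a a', T (iA a) (iA a') = 0) ->
  (forall a b, T (iA a) (iB b) = 0) ->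
  (forall b b', T (iB b) (iB b') = 0) -> forall x y, T x y = 0.
Proof.
move=> TD Ts AA AB BB x y; move: y; apply: additive_eq0 => [|a|b].
- exact: skew_addr.
- by move: x; apply: additive_eq0 => // b; rewrite Ts AB oppr0.
- by move: x; apply: additive_eq0.
Qed.

(** Freeze the last argument, apply the case of two arguments to the others, then split the last
    one. If it lies in [A], transpositions move it left past the arguments from [B]. The case of
    four arguments follows from this one in the same way. *)
Lemma alternating3_eq0 (T : Q -> Q -> Q -> V) :
  (forall y z, {morph (fun x => T x y z) : x x' / x + x'}) ->
  (forall x y z, T x y z = - T y x z) ->
  (forall x y z, T x y z = - T x z y) ->
  (forall a a' a'', T (iA a) (iA a') (iA a'') = 0) ->
  (forall a a' b, T (iA a) (iA a') (iB b) = 0) ->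
  (forall a b b', T (iA a) (iB b) (iB b') = 0) ->
  (forall b b' b'', T (iB b) (iB b') (iB b'') = 0) -> forall x y z, T x y z = 0.
Proof.
move=> TD T12 T23 AAA AAB ABB BBB x y z.
have TD2 u w : {morph (fun v => T u v w) : v v' / v + v'}.
  exact: (skew_addr (f := fun u v => T u v w)).
have TD3 u v : {morph T u v : w w' / w + w'} by exact: skew_addr.
move: x y; apply: alternating2_eq0 => // [a a'|a b|b b'].
- exact: additive_eq0.
- by move: z; apply: additive_eq0 => // a'; rewrite T23 AAB oppr0.
- by move: z; apply: additive_eq0 => // a; rewrite T23 T12 ABB !oppr0.
Qed.

Lemma alternating4_eq0 (T : Q -> Q -> Q -> Q -> V) :
  (forall y z t, {morph (fun x => T x y z t) : x x' / x + x'}) ->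
  (forall x y z t, T x y z t = - T y x z t) ->
  (forall x y z t, T x y z t = - T x z y t) ->
  (forall x y z t, T x y z t = - T x y t z) ->
  (forall a1 a2 a3 a4, T (iA a1) (iA a2) (iA a3) (iA a4) = 0) ->
  (forall a1 a2 a3 b, T (iA a1) (iA a2) (iA a3) (iB b) = 0) ->
  (forall a1 a2 b1 b2, T (iA a1) (iA a2) (iB b1) (iB b2) = 0) ->
  (forall a b1 b2 b3, T (iA a) (iB b1) (iB b2) (iB b3) = 0) ->
  (forall b1 b2 b3 b4, T (iB b1) (iB b2) (iB b3) (iB b4) = 0) ->
  forall x y z t, T x y z t = 0.
Proof.
move=> TD T12 T23 T34 A4 A3B A2B2 AB3 B4 x y z t.
have TD2 u w s : {morph (fun v => T u v w s) : v v' / v + v'}.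
  exact: (skew_addr (f := fun u v => T u v w s)).
have TD3 u v s : {morph (fun w => T u v w s) : w w' / w + w'}.
  exact: (skew_addr (f := fun v w => T u v w s)).
have TD4 u v w : {morph T u v w : s s' / s + s'} by exact: skew_addr.
move: x y z; apply: alternating3_eq0 => //.
- by move=> *; apply: additive_eq0.
- move=> a1 a2 b; move: t; apply: additive_eq0 => // a.
  by rewrite T34 A3B oppr0.
- move=> a1 b1 b2; move: t; apply: additive_eq0 => // a.
  by rewrite T34 T23 A2B2 !oppr0.
- move=> b1 b2 b3; move: t; apply: additive_eq0 => // a.
  by rewrite T34 T23 T12 AB3 !oppr0.
Qed.

End Alternation.

(** * Alternation of the curvature and of the covariant differential of a 3-form *)

Section Koszul.
Context {X V : zmodType} (nab : X -> V -> V) (br : X -> X -> X).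
Hypothesis nabDl : forall v, {morph nab^~ v : x y / x + y}.
Hypothesis nabDr : forall x, {morph nab x : v w / v + w}.
Hypothesis brDl : forall y, {morph br^~ y : x x' / x + x'}.
Hypothesis br_skew : forall x y, br x y = - br y x.

Let nabNr x v : nab x (- v) = - nab x v := morphDN (nabDr x) v.

Lemma curv_skew v x y : curv nab br x y v = - curv nab br y x v.
Proof.
by rewrite /curv br_skew (morphDN (nabDl v)); zmod.
Qed.

Lemma curvD v y : {morph (fun x => curv nab br x y v) : x x' / x + x'}.
Proof. by move=> x x'; rewrite /curv brDl !nabDl nabDr; zmod. Qed.

Section ThreeForm.
Variable w : X -> X -> X -> V.
Hypothesis wD : forall y z, {morph (fun x => w x y z) : x x' / x + x'}.
Hypothesis w12 : forall x y z, w x y z = - w y x z.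
Hypothesis w23 : forall x y z, w x y z = - w x z y.

Let wN x y z : w (- x) y z = - w x y z := morphDN (wD y z) x.
Let wD2 x z : {morph (fun y => w x y z) : y y' / y + y'}.
Proof. by move=> y y'; rewrite w12 wD opprD -!(w12 x). Qed.

Lemma dnab3D y z t : {morph (fun x => dnab3 nab br w x y z t) : x x' / x + x'}.
Proof.
by move=> x x'; rewrite /dnab3 !brDl !wD !wD2 nabDl !nabDr; zmod.
Qed.

(** Swapping two neighbours permutes the ten terms of the Koszul formula up to sign. The rewrites
    put the arguments of [br] and [w] in the same order on both sides, so that [zmod] can match the
    terms as atoms. The other two neighbouring swaps go the same way. *)
Lemma dnab3_skew12 x y z t :
  dnab3 nab br w x y z t = - dnab3 nab br w y x z t.
Proof.
rewrite /dnab3 (br_skew y x) !(w12 y x) (w23 (br z t) y x) !wN !nabNr.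
zmod.
Qed.

Lemma dnab3_skew23 x y z t :
  dnab3 nab br w x y z t = - dnab3 nab br w x z y t.
Proof.
rewrite /dnab3 (br_skew z y) (w12 z y) (w23 x z y) (w23 (br x t) z y).
rewrite !wN !nabNr.
zmod.
Qed.

Lemma dnab3_skew34 x y z t :
  dnab3 nab br w x y z t = - dnab3 nab br w x y t z.
Proof.
rewrite /dnab3 (br_skew t z) (w23 x t z) (w23 y t z) (w23 (br x y) t z).
rewrite !wN !nabNr.
zmod.
Qed.

End ThreeForm.
End Koszul.

(** * Operations on sections *)

Section Operations.
Context {R : realType} {M : manifold R}.
Implicit Types A B C E F Q : vector_bundle M.

Lemma bmapZD E F (phi : bundle_map E F) f s t :
  phi (f *: s + t) = f *: phi s + phi t.
Proof. by apply: gammaE => x; exact: bfib_linear. Qed.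

Lemma bmapD E F (phi : bundle_map E F) : {morph phi : s t / s + t}.
Proof. by move=> s t; have := bmapZD phi 1 s t; rewrite !scale1r. Qed.

Lemma bmap0 E F (phi : bundle_map E F) : phi 0 = 0.
Proof. by apply: (@addrI _ (phi 0)); rewrite -bmapD !addr0. Qed.

Lemma bmapN E F (phi : bundle_map E F) : {morph phi : s / - s}.
Proof. by move=> s; apply: (@addrI _ (phi s)); rewrite -bmapD !subrr bmap0. Qed.

Lemma bmapZ E F (phi : bundle_map E F) f s : phi (f *: s) = f *: phi s.
Proof. by rewrite -[f *: s]addr0 bmapZD bmap0 addr0. Qed.

Lemma anchorZD Q (r : anchor Q) f q q' g :
  r (f *: q + q') g = f * r q g + r q' g.
Proof. by apply: val_inj; apply/funext => x; exact: afib_linear. Qed.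

Lemma linear_additive (V W : lmodType R) (f : V -> W) : linear f ->
  {morph f : x y / x + y}.
Proof. by move=> fl x y; have := fl 1 x y; rewrite !scale1r. Qed.

Lemma o2Dl A E F (w : omega2 A E F) a' e :
  {morph (fun a => w a a' e) : x y / x + y}.
Proof.
by move=> x y; apply: gammaE => z; exact: (linear_additive (o2_linear1 _ _ _)).
Qed.

Lemma o2Dm A E F (w : omega2 A E F) a e :
  {morph (fun a' => w a a' e) : x y / x + y}.
Proof.
by move=> x y; apply: gammaE => z; exact: (linear_additive (o2_linear2 _ _ _)).
Qed.

Lemma o2Dr A E F (w : omega2 A E F) a a' : {morph w a a' : x y / x + y}.
Proof.
by move=> x y; apply: gammaE => z; exact: (linear_additive (o2_linear3 _ _ _)).
Qed.

Lemma o2Zl A E F (w : omega2 A E F) f a a' e : w (f *: a) a' e = f *: w a a' e.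
Proof.
apply: gammaE => x /=; have := o2_linear1 w (a' x) (e x) (f x) (a x) 0.
by rewrite addr0 (morphD0 (linear_additive (o2_linear1 w _ _))) addr0.
Qed.

Lemma o2S A E F (w : omega2 A E F) a a' e : w a a' e = - w a' a e.
Proof.
apply: (skew_of_alt (f := fun a a' => w a a' e)) => [a1|a1|a1].
- exact: o2Dl.
- exact: o2Dm.
- by apply: gammaE => x; exact: o2_alt.
Qed.

Lemma o3D Q F (w : omega3 Q F) y z : {morph (fun x => w x y z) : x x' / x + x'}.
Proof.
by move=> x x'; apply: gammaE => p; exact: (linear_additive (o3_linear1 _ _ _)).
Qed.

Lemma o3S12 Q F (w : omega3 Q F) x y z : w x y z = - w y x z.
Proof.
apply: (skew_of_alt (f := fun x y => w x y z)) => [u|u|u].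
- exact: o3D.
- move=> v v'; apply: gammaE => p.
  exact: (linear_additive (o3_linear2 _ _ _)).
- by apply: gammaE => p; exact: o3_alt12.
Qed.

Lemma o3S23 Q F (w : omega3 Q F) x y z : w x y z = - w x z y.
Proof.
apply: (skew_of_alt (f := w x)) => [u|u|u].
- move=> v v'; apply: gammaE => p.
  exact: (linear_additive (o3_linear2 _ _ _)).
- move=> v v'; apply: gammaE => p.
  exact: (linear_additive (o3_linear3 _ _ _)).
- by apply: gammaE => p; exact: o3_alt23.
Qed.

Lemma anchorD Q (r : anchor Q) g : {morph (fun q => r q g) : q q' / q + q'}.
Proof. by move=> q q'; have := anchorZD r 1 q q' g; rewrite scale1r mul1r. Qed.

Lemma anchorZ Q (r : anchor Q) f q g : r (f *: q) g = f * r q g.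
Proof. by rewrite -[f *: q]addr0 anchorZD (morphD0 (anchorD r g)) addr0. Qed.

Lemma anchor_funD Q (r : anchor Q) q : {morph r q : f g / f + g}.
Proof.
move=> f g; apply: val_inj; apply/funext => x /=.
have := tval_linear (afib r (q x)) 1 f g; rewrite mul1r.
suff -> : cst_cinf 1 * f = f by [].
by apply: val_inj; apply/funext => y; exact: mul1r.
Qed.

(** The ring of smooth functions has no nilpotents, because its values lie in a field. *)
Lemma Cinf_sqr_eq0 (h : Cinf M) : h * h = 0 -> h = 0.
Proof.
move=> h2; apply: val_inj; apply/funext => x.
have : h x * h x = 0 := f_equal (fun g : Cinf M => g x) h2.
by move/eqP; rewrite mulf_eq0 orbb => /eqP.
Qed.

Section Connection.
Context {Q E : vector_bundle M} {r : anchor Q}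
  {nab : Gamma Q -> Gamma E -> Gamma E}.
Hypothesis nab_conn : is_connection r nab.

Lemma nabDl e : {morph nab^~ e : q q' / q + q'}.
Proof.
by move=> q q'; have := nab_linear nab_conn 1 q q' e; rewrite !scale1r.
Qed.

Lemma nabDr q : {morph nab q : e e' / e + e'}.
Proof. by move=> e e'; exact: (nab_add nab_conn). Qed.

Lemma nabZl f q e : nab (f *: q) e = f *: nab q e.
Proof.
by rewrite -[f *: q]addr0 (nab_linear nab_conn) (morphD0 (nabDl e)) addr0.
Qed.
End Connection.

Section Dull.
Context {Q : vector_bundle M} {D : bracket_data Q}.
Hypothesis D_dull : is_dull D.

Lemma brkDr q : {morph brk D q : x y / x + y}.
Proof. by move=> x y; exact: (brk_add D_dull). Qed.

Lemma brkDl q : {morph (brk D)^~ q : x y / x + y}.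
Proof.
by move=> x y; rewrite brk_skew // brkDr opprD -!(brk_skew D_dull _ q).
Qed.

Lemma brkZl f x y : brk D (f *: x) y = f *: brk D x y - rho D y f *: x.
Proof.
rewrite (brk_skew D_dull) (brk_leibniz D_dull) (brk_skew D_dull y x).
by rewrite scalerN opprD opprK.
Qed.

Lemma jacD y z : {morph (fun x => jac D x y z) : x x' / x + x'}.
Proof. by move=> x x'; rewrite /jac !brkDl // !brkDr //; zmod. Qed.

Lemma jac_skew12 x y z : jac D x y z = - jac D y x z.
Proof.
by rewrite /jac (brk_skew D_dull y x) (morphDN (brkDl z)); zmod.
Qed.

Lemma jac_skew23 x y z : jac D x y z = - jac D x z y.
Proof.
rewrite /jac (brk_skew D_dull z y) (brk_skew D_dull z).
by rewrite (brk_skew D_dull (brk D x z) y) (morphDN (brkDr x)); zmod.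
Qed.
End Dull.

(** This tuple and the next ones are multirules for [rewrite]: sums, opposites and zero in each
    slot. *)
Definition bmap_rules E F (phi : bundle_map E F) :=
  (bmapD phi, bmapN phi, bmap0 phi).

Definition o2_rules A E F (w : omega2 A E F) :=
  (fun a' e => o2Dl w a' e, fun a' e => morphDN (o2Dl w a' e),
   fun a' e => morphD0 (o2Dl w a' e),
   fun a e => o2Dm w a e, fun a e => morphDN (o2Dm w a e),
   fun a e => morphD0 (o2Dm w a e),
   fun a a' => o2Dr w a a', fun a a' => morphDN (o2Dr w a a'),
   fun a a' => morphD0 (o2Dr w a a')).

Definition nab_rules Q E (r : anchor Q) (nab : Gamma Q -> Gamma E -> Gamma E)
    (h : is_connection r nab) :=
  (fun e => nabDl h e, fun e => morphDN (nabDl h e),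
   fun e => morphD0 (nabDl h e),
   fun q => nabDr h q, fun q => morphDN (nabDr h q),
   fun q => morphD0 (nabDr h q)).

Definition brk_rules Q (D : bracket_data Q) (h : is_dull D) :=
  (fun q => brkDl h q, fun q => morphDN (brkDl h q),
   fun q => morphD0 (brkDl h q),
   fun q => brkDr h q, fun q => morphDN (brkDr h q),
   fun q => morphD0 (brkDr h q)).

Definition anchor_rules Q (r : anchor Q) :=
  (fun g => anchorD r g, fun g => morphDN (anchorD r g),
   fun g => morphD0 (anchorD r g), fun q => anchor_funD r q,
   fun q => morphDN (anchor_funD r q), fun q => morphD0 (anchor_funD r q)).

End Operations.

(** * Sections of a direct sum *)

Section Pairs.
Context {R : realType} {M : manifold R} {A B : vector_bundle M}.
Implicit Types (a : Gamma A) (b : Gamma B).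

Lemma prA_gpair a b : prA A B (gpair a b) = a. Proof. exact: gammaE. Qed.
Lemma prB_gpair a b : prB A B (gpair a b) = b. Proof. exact: gammaE. Qed.
Lemma gpair_pr q : gpair (prA A B q) (prB A B q) = q.
Proof. by apply: gammaE => x /=; case: (q x). Qed.
Lemma gpairD a b a' b' : gpair a b + gpair a' b' = gpair (a + a') (b + b').
Proof. exact: gammaE. Qed.
Lemma gpairN a b : - gpair a b = gpair (- a) (- b).
Proof. exact: gammaE. Qed.
Lemma gpairZ f a b : f *: gpair a b = gpair (f *: a) (f *: b).
Proof. exact: gammaE. Qed.
Lemma gpair0 : gpair 0 0 = 0 :> Gamma (dsum A B).
Proof. exact: gammaE. Qed.
Lemma inAE a : inA A B a = gpair a 0. Proof. exact: gammaE. Qed.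
Lemma inBE b : inB A B b = gpair 0 b. Proof. exact: gammaE. Qed.
Lemma gpair_inj a b a' b' : gpair a b = gpair a' b' -> a = a' /\ b = b'.
Proof.
move=> e; split; first by rewrite -(prA_gpair a b) e prA_gpair.
by rewrite -(prB_gpair a b) e prB_gpair.
Qed.
Lemma gpair_eq0 a b : gpair a b = 0 -> a = 0 /\ b = 0.
Proof. by rewrite -gpair0 => /gpair_inj. Qed.

Lemma dsum_split (q : Gamma (dsum A B)) :
  exists a b, q = inA A B a + inB A B b.
Proof.
exists (prA A B q), (prB A B q).
by rewrite inAE inBE gpairD addr0 add0r gpair_pr.
Qed.
End Pairs.

(** * The double on homogeneous arguments *)

Section Double.
Context {R : realType} {M : manifold R} {A B C : vector_bundle M}.
Variables (LA : bracket_data A) (LB : bracket_data B).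
Variables (DA : rep2_data A C B) (DB : rep2_data B C A).

Local Notation brA := (brk LA).
Local Notation brB := (brk LB).
Local Notation dB := (rdiff DA).
Local Notation nAC := (rnab0 DA).
Local Notation nAB := (rnab1 DA).
Local Notation RAB := (rcurv DA).
Local Notation dA := (rdiff DB).
Local Notation nBC := (rnab0 DB).
Local Notation nBA := (rnab1 DB).
Local Notation RBA := (rcurv DB).
Local Notation D := (bicrossproduct LA LB DA DB).
Local Notation iA := (inA A B).
Local Notation iB := (inB A B).

Lemma double_rhoE a b f : rho D (gpair a b) f = rho LA a f + rho LB b f.
Proof.
apply: val_inj; apply/funext => x /=.
by congr (afib _ _ _ + afib _ _ _).
Qed.

Lemma double_brkE a b a' b' : brk D (gpair a b) (gpair a' b') =
  gpair (brA a a' + nBA b a' - nBA b' a) (brB b b' + nAB a b' - nAB a' b).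
Proof. by rewrite /= /double_brk !prA_gpair !prB_gpair. Qed.

Lemma double_l1E c : sl_l1 D c = gpair (- dA c) (dB c).
Proof. exact: gammaE. Qed.

Lemma double_nabE a b c : sl_nab D (gpair a b) c = nAC a c + nBC b c.
Proof. by rewrite /= /double_nab prA_gpair prB_gpair. Qed.

Lemma double_l3E a1 b1 a2 b2 a3 b3 :
  sl_l3 D (gpair a1 b1) (gpair a2 b2) (gpair a3 b3) =
  RAB a1 a2 b3 + RAB a2 a3 b1 + RAB a3 a1 b2
  - RBA b1 b2 a3 - RBA b2 b3 a1 - RBA b3 b1 a2.
Proof. exact: gammaE. Qed.

Hypotheses (dullA : is_dull LA) (dullB : is_dull LB).
Hypotheses (conAC : is_connection (rho LA) nAC)
  (conAB : is_connection (rho LA) nAB) (conBC : is_connection (rho LB) nBC)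
  (conBA : is_connection (rho LB) nBA).

(** Reduces an expression in the double to sums of terms in the component structures, with all zero
    arguments removed. *)
Local Ltac expand :=
  rewrite ?(inAE, inBE, double_l1E, double_brkE, double_nabE, double_l3E,
    gpairD, gpairN,
    brk_rules dullA, brk_rules dullB, nab_rules conAC, nab_rules conAB,
    nab_rules conBC, nab_rules conBA, bmap_rules dA, bmap_rules dB,
    o2_rules RAB, o2_rules RBA, addr0, add0r, subr0, sub0r, oppr0, opprK).

(** In the names below, [A] and [B] mark arguments from one summand, [l] and [r] the side of that
    argument in a bracket, and [_] an arbitrary pair. Pairs are needed because the bracket of a
    section of [A] with one of [B] has both components. *)
Lemma double_brkAl a a' b' : brk D (iA a) (gpair a' b') =
  gpair (brA a a' - nBA b' a) (nAB a b').
Proof. by expand. Qed.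

Lemma double_brkBl b a' b' : brk D (iB b) (gpair a' b') =
  gpair (nBA b a') (brB b b' - nAB a' b).
Proof. by expand. Qed.

Lemma double_brkBr b a' b' : brk D (gpair a' b') (iB b) =
  gpair (- nBA b a') (brB b' b + nAB a' b).
Proof. by expand. Qed.

Lemma double_brkAA a a' : brk D (iA a) (iA a') = iA (brA a a').
Proof. by expand. Qed.

Lemma double_brkAB a b : brk D (iA a) (iB b) = gpair (- nBA b a) (nAB a b).
Proof. by expand. Qed.

Lemma double_brkBB b b' : brk D (iB b) (iB b') = iB (brB b b').
Proof. by expand. Qed.

Lemma double_nabA a c : sl_nab D (iA a) c = nAC a c.
Proof. by expand. Qed.

Lemma double_nabB b c : sl_nab D (iB b) c = nBC b c.
Proof. by expand. Qed.

Lemma double_l3_AA a b a2 a3 :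
  sl_l3 D (gpair a b) (iA a2) (iA a3) = RAB a2 a3 b.
Proof. by expand. Qed.

Lemma double_l3_AB a b a2 b3 :
  sl_l3 D (gpair a b) (iA a2) (iB b3) = RAB a a2 b3 - RBA b3 b a2.
Proof. by expand. Qed.

Lemma double_l3_BB a b b2 b3 :
  sl_l3 D (gpair a b) (iB b2) (iB b3) = - RBA b2 b3 a.
Proof. by expand. Qed.

Lemma double_l3AA_ a b a1 a2 :
  sl_l3 D (iA a1) (iA a2) (gpair a b) = RAB a1 a2 b.
Proof. by expand. Qed.

Lemma double_l3AB_ a b a1 b2 :
  sl_l3 D (iA a1) (iB b2) (gpair a b) = RAB a a1 b2 - RBA b2 b a1.
Proof. by expand. Qed.

Lemma double_l3BB_ a b b1 b2 :
  sl_l3 D (iB b1) (iB b2) (gpair a b) = - RBA b1 b2 a.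
Proof. by expand. Qed.

Lemma double_l3AAA a1 a2 a3 : sl_l3 D (iA a1) (iA a2) (iA a3) = 0.
Proof. by expand. Qed.

Lemma double_l3AAB a1 a2 b3 : sl_l3 D (iA a1) (iA a2) (iB b3) = RAB a1 a2 b3.
Proof. by expand. Qed.

Lemma double_l3ABB a1 b2 b3 : sl_l3 D (iA a1) (iB b2) (iB b3) = - RBA b2 b3 a1.
Proof. by expand. Qed.

Lemma double_l3BAA b1 a2 a3 : sl_l3 D (iB b1) (iA a2) (iA a3) = RAB a2 a3 b1.
Proof. by expand. Qed.

Lemma double_l3BAB b1 a2 b3 : sl_l3 D (iB b1) (iA a2) (iB b3) = - RBA b3 b1 a2.
Proof. by expand. Qed.

Lemma double_l3BBB b1 b2 b3 : sl_l3 D (iB b1) (iB b2) (iB b3) = 0.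
Proof. by expand. Qed.

(** Uses the short formulas for arguments from one summand before [expand], which avoids producing
    terms that vanish. *)
Local Ltac pure :=
  rewrite ?(double_brkAA, double_brkAB, double_brkBB, double_nabA, double_nabB,
    double_l3AAA, double_l3AAB, double_l3ABB, double_l3BAA, double_l3BAB,
    double_l3BBB, double_brkAl, double_brkBl, double_brkBr,
    double_l3_AA, double_l3_AB, double_l3_BB, double_l3AA_, double_l3AB_,
    double_l3BB_).

(** From here to [double_closedA2B2], the failure of an axiom of the double is computed as the
    failure of axioms of the components. These identities rest on dullness and the connection rules
    of the components, and so serve both directions. *)
Lemma double_skewE c1 c2 :
  sl_nab D (sl_l1 D c1) c2 + sl_nab D (sl_l1 D c2) c1 =
  (- nAC (dA c2) c1 + nBC (dB c1) c2) - (nAC (dA c1) c2 - nBC (dB c2) c1).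
Proof. by expand; zmod. Qed.

Lemma double_equivariantA a c :
  brk D (iA a) (sl_l1 D c) - sl_l1 D (sl_nab D (iA a) c) =
  gpair (dA (nAC a c) - nBA (dB c) a - brA a (dA c))
        (nAB a (dB c) - dB (nAC a c)).
Proof. by expand; congr gpair; zmod. Qed.

Lemma double_equivariantB b c :
  brk D (iB b) (sl_l1 D c) - sl_l1 D (sl_nab D (iB b) c) =
  gpair (dA (nBC b c) - nBA b (dA c))
        (brB b (dB c) - (dB (nBC b c) - nAB (dA c) b)).
Proof. by expand; congr gpair; zmod. Qed.

Lemma double_jacAAA a1 a2 a3 :
  jac D (iA a1) (iA a2) (iA a3) + sl_l1 D (sl_l3 D (iA a1) (iA a2) (iA a3)) =
  gpair (jac LA a1 a2 a3) 0.
Proof. by rewrite /jac; pure; expand. Qed.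

(** One axiom of the double splits in two: [mp5] in the component in [A], and [rep2_curv1] of [DA]
    in the component in [B]. In [double_jacABB] the roles are exchanged. *)
Lemma double_jacAAB a1 a2 b :
  jac D (iA a1) (iA a2) (iB b) + sl_l1 D (sl_l3 D (iA a1) (iA a2) (iB b)) =
  gpair (- nBA b (brA a1 a2) + brA (nBA b a1) a2 + brA a1 (nBA b a2)
           + nBA (nAB a2 b) a1 - nBA (nAB a1 b) a2 - dA (RAB a1 a2 b))
        (dB (RAB a1 a2 b) - curv nAB brA a1 a2 b).
Proof.
rewrite /jac /curv; pure; expand; rewrite (brk_skew dullA a2).
by congr gpair; zmod.
Qed.

Lemma double_jacABB a b1 b2 :
  jac D (iA a) (iB b1) (iB b2) + sl_l1 D (sl_l3 D (iA a) (iB b1) (iB b2)) =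
  gpair (dA (RBA b1 b2 a) - curv nBA brB b1 b2 a)
        (- nAB a (brB b1 b2) + brB (nAB a b1) b2 + brB b1 (nAB a b2)
           + nAB (nBA b2 a) b1 - nAB (nBA b1 a) b2 - dB (RBA b1 b2 a)).
Proof. by rewrite /jac /curv; pure; expand; congr gpair; zmod. Qed.

Lemma double_jacBBB b1 b2 b3 :
  jac D (iB b1) (iB b2) (iB b3) + sl_l1 D (sl_l3 D (iB b1) (iB b2) (iB b3)) =
  gpair 0 (jac LB b1 b2 b3).
Proof. by rewrite /jac; pure; expand. Qed.

Lemma double_curvAA a1 a2 c :
  curv (sl_nab D) (brk D) (iA a1) (iA a2) c
    - sl_l3 D (iA a1) (iA a2) (sl_l1 D c) =
  curv nAC brA a1 a2 c - RAB a1 a2 (dB c).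
Proof. by rewrite /curv double_l1E; pure; expand. Qed.

Lemma double_curvAB a b c :
  curv (sl_nab D) (brk D) (iA a) (iB b) c
    - sl_l3 D (iA a) (iB b) (sl_l1 D c) =
  (RBA b (dB c) a - RAB a (dA c) b)
  - (nBC b (nAC a c) - nAC a (nBC b c) - nAC (nBA b a) c + nBC (nAB a b) c).
Proof.
by rewrite /curv double_l1E; pure; expand; rewrite (o2S RAB (dA c)); zmod.
Qed.

Lemma double_curvBB b1 b2 c :
  curv (sl_nab D) (brk D) (iB b1) (iB b2) c
    - sl_l3 D (iB b1) (iB b2) (sl_l1 D c) =
  curv nBC brB b1 b2 c - RBA b1 b2 (dA c).
Proof. by rewrite /curv double_l1E; pure; expand. Qed.

Lemma double_closedA4 a1 a2 a3 a4 :
  dnab3 (sl_nab D) (brk D) (sl_l3 D) (iA a1) (iA a2) (iA a3) (iA a4) = 0.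
Proof. by rewrite /dnab3; pure; expand. Qed.

Lemma double_closedB4 b1 b2 b3 b4 :
  dnab3 (sl_nab D) (brk D) (sl_l3 D) (iB b1) (iB b2) (iB b3) (iB b4) = 0.
Proof. by rewrite /dnab3; pure; expand. Qed.

Lemma double_closedA3B a1 a2 a3 b :
  dnab3 (sl_nab D) (brk D) (sl_l3 D) (iA a1) (iA a2) (iA a3) (iB b) =
  dnab2 (nab_hom nAC nAB) brA RAB a1 a2 a3 b.
Proof.
by rewrite /dnab3 /dnab2 /nab_hom !fctE; pure; expand; zmod.
Qed.

Lemma double_closedAB3 a b1 b2 b3 :
  dnab3 (sl_nab D) (brk D) (sl_l3 D) (iA a) (iB b1) (iB b2) (iB b3) =
  dnab2 (nab_hom nBC nBA) brB RBA b1 b2 b3 a.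
Proof.
rewrite /dnab3 /dnab2 /nab_hom !fctE; pure; expand.
rewrite !(o2S RBA _ (brB _ _)).
zmod.
Qed.

(** The mixed brackets supply the terms of the induced connections on the exterior squares, and the
    minus sign of [RBA] in [sl_l3] turns the sum into the difference of the two sides of [mp7]. *)
Lemma double_closedA2B2 a1 a2 b1 b2 :
  dnab3 (sl_nab D) (brk D) (sl_l3 D) (iA a1) (iA a2) (iB b1) (iB b2) =
  dnab1 (nab_wedge2 nBA nBC) brB (fun b a a' => RAB a a' b) b1 b2 a1 a2
  - dnab1 (nab_wedge2 nAB nAC) brA (fun a b b' => RBA b b' a) a1 a2 b1 b2.
Proof.
rewrite /dnab3 /dnab1 /nab_wedge2 !fctE; pure; expand.
rewrite !(o2S RBA b2) !(o2S RAB (nBA _ _)).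
zmod.
Qed.

(** * Compatibility of the anchors *)

(** The commutator of the anchors of [b] and [a], minus the anchor of their bracket in the double,
    applied to [f]. *)
Definition anchor_defect a b f : Cinf M :=
  rho LB b (rho LA a f) - rho LA a (rho LB b f)
  - rho LA (nBA b a) f + rho LB (nAB a b) f.

(** Put [f *: a'] for the first section of [A] in [mp5]. The left side is linear over functions,
    while the Leibniz rules on the right leave exactly the defect times [a']. *)
Lemma anchor_defectA : is_matched_pair LA LB DA DB ->
  forall a (a' : Gamma A) b f, anchor_defect a b f *: a' = 0.
Proof.
move=> mp a a' b f; have := mp5 mp (f *: a') a b.
rewrite o2Zl bmapZ (mp5 mp) !(brkZl dullA) !(nabZl conAB) !(nabZl conBA).
rewrite !(nab_leibniz conBA) (brkDl dullA) !(brkZl dullA).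
rewrite (nabDr conBA) (morphDN (nabDr conBA b)) !(nab_leibniz conBA).
move=> /esym E; apply: (eq_by_diff E).
rewrite /anchor_defect !(scalerDl, scaleNr, scalerDr, scalerN).
zmod.
Qed.

Lemma anchor_defectB : is_matched_pair LA LB DA DB ->
  forall a b (b' : Gamma B) f, anchor_defect a b f *: b' = 0.
Proof.
move=> mp a b b' f; have := mp6 mp (f *: b') b a.
rewrite o2Zl bmapZ (mp6 mp) !(brkZl dullB) !(nabZl conBA) !(nabZl conAB).
rewrite !(nab_leibniz conAB) (brkDl dullB) !(brkZl dullB).
rewrite (nabDr conAB) (morphDN (nabDr conAB a)) !(nab_leibniz conAB).
move=> E; apply: (eq_by_diff E).
rewrite /anchor_defect !(scalerDl, scaleNr, scalerDr, scalerN).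
zmod.
Qed.

(** Annihilating all sections says nothing about a function when the rank is zero; passing to the
    square avoids any condition on ranks and any choice of nonvanishing sections. *)
Lemma anchor_defect_eq0 : is_matched_pair LA LB DA DB ->
  forall a b f, anchor_defect a b f = 0.
Proof.
move=> mp a b f; apply: Cinf_sqr_eq0; set h := anchor_defect a b f.
(* Only the second factor is unfolded; the first moves into the section along which each term
   differentiates, and kills it. *)
rewrite {2}/h /anchor_defect !mulrDr !mulrN -!anchorZ.
rewrite !(anchor_defectA mp) !(anchor_defectB mp).
by rewrite !(morphD0 (anchorD _ _)) !subr0 addr0.
Qed.

Lemma double_dull : (forall a b f, anchor_defect a b f = 0) -> is_dull D.
Proof.
move=> h0; split=> q; rewrite -(gpair_pr q);
  move: (prA _ _ q) (prB _ _ q) => a b.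
- move=> q1 q2; rewrite -(gpair_pr q1) -(gpair_pr q2) !(gpairD, double_brkE).
  rewrite !(brkDr dullA) !(brkDr dullB) !(nabDl conBA) !(nabDl conAB).
  by rewrite (nabDr conAB) (nabDr conBA); congr gpair; zmod.
- move=> q'; rewrite -(gpair_pr q') !double_brkE gpairN.
  by rewrite (brk_skew dullA a) (brk_skew dullB b); congr gpair; zmod.
- move=> f q'; rewrite -(gpair_pr q') !(gpairZ, double_brkE, gpairD).
  rewrite (brk_leibniz dullA) (brk_leibniz dullB) (nab_leibniz conBA).
  rewrite (nab_leibniz conAB) (nabZl conAB) (nabZl conBA) double_rhoE.
  by congr gpair; rewrite !(scalerDl, scalerDr, scalerN); zmod.
- move=> q' f; rewrite -(gpair_pr q'); move: (prA _ _ q') (prB _ _ q') => a' b'.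
  rewrite double_brkE !double_rhoE.
  rewrite !(anchor_rules (rho LA)) !(anchor_rules (rho LB)).
  rewrite (brk_anchor dullA) (brk_anchor dullB).
  (* Besides the anchor identities inside [A] and inside [B], the two mixed pairs contribute one
     defect each, with opposite signs. *)
  have := f_equal2 (fun x y => x - y) (h0 a b' f) (h0 a' b f).
  by move/eq_by_diff; apply; rewrite /anchor_defect; zmod.
Qed.

Lemma double_connection : is_connection (rho D) (sl_nab D).
Proof.
split=> [f q q' c|q c c'|q f c].
- rewrite -(gpair_pr q) -(gpair_pr q') gpairZ gpairD !double_nabE.
  by rewrite (nab_linear conAC) (nab_linear conBC) scalerDr; zmod.
- rewrite -(gpair_pr q) !double_nabE (nabDr conAC) (nabDr conBC); zmod.
- rewrite -(gpair_pr q) !double_nabE (nab_leibniz conAC) (nab_leibniz conBC).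
  by rewrite double_rhoE !(scalerDl, scalerDr); zmod.
Qed.

End Double.

(** * Matched pairs and doubles *)

Section Transfer.
Context {R : realType} {M : manifold R} {Q C : vector_bundle M}.

(** The axioms see the structure maps only through their values on sections and functions, which
    [split_lie2_eq] identifies. *)
Lemma split_lie2_transfer (S T : split_lie2_data Q C) :
  split_lie2_eq S T -> is_split_lie2 S -> is_split_lie2 T.
Proof.
move=> [er eb el en e3] [[bD bS bL bA] [nL nD nZ] sk eq ja cu cl]; split.
- split=> [q q1 q2|q1 q2|q1 f q2|q1 q2 f]; rewrite -?eb -?er.
  + exact: bD.
  + exact: bS.
  + exact: bL.
  + exact: bA.
- by split=> *; rewrite -!en -?er.
- by move=> c1 c2; rewrite -!el -!en.
- by move=> q c; rewrite -!el -en -eb.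
- by move=> q1 q2 q3; rewrite /jac -!eb -el -e3; exact: ja.
- by move=> q1 q2 c; rewrite /curv -!en -eb -el -e3; exact: cu.
- by move=> q1 q2 q3 q4; rewrite /dnab3 -!en -!eb -!e3; exact: cl.
Qed.
End Transfer.

Section MatchedPairs.
Context {R : realType} {M : manifold R} {A B C : vector_bundle M}.
Variables (LA : bracket_data A) (LB : bracket_data B).
Variables (DA : rep2_data A C B) (DB : rep2_data B C A).
Local Notation D := (bicrossproduct LA LB DA DB).
Local Notation iA := (inA A B).
Local Notation iB := (inB A B).

Lemma matched_pair_split_lie2 :
  is_lie_algebroid LA -> is_lie_algebroid LB ->
  is_rep2 LA DA -> is_rep2 LB DB ->
  is_matched_pair LA LB DA DB -> is_split_lie2 D.
Proof.
move=> [duA jaA] [duB jaB].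
move=> [cAC cAB dfA c0A c1A biA] [cBC cBA dfB c0B c1B biB] mp.
(* Dullness comes first: the additivity and alternation of the expressions below rest on it. *)
have duD : is_dull D.
  by apply: double_dull => //; exact: anchor_defect_eq0.
have cD : is_connection (rho D) (sl_nab D) by exact: double_connection.
split=> //.
- move=> c1 c2; rewrite double_skewE // (mp1 mp) subrr //.
(* As for the later axioms, the equation becomes the vanishing of an additive expression, to be
   tested on the summands. *)
- move=> q c; apply/eqP; rewrite -subr_eq0; apply/eqP; move: q.
  apply: (additive_eq0 dsum_split) => [q q'|a|b].
  + rewrite (brkDl duD) (nabDl cD) bmapD; zmod.
  + rewrite double_equivariantA // (mp2 mp) (dfA a) !subrr gpair0 //.
  + rewrite double_equivariantB // (mp3 mp) (dfB b) !subrr gpair0 //.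
- move=> q1 q2 q3; apply/eqP; rewrite -addr_eq0; apply/eqP; move: q1 q2 q3.
  apply: (alternating3_eq0 dsum_split).
  + move=> y z x x'; rewrite (jacD duD) o3D bmapD; zmod.
  + move=> x y z; rewrite (jac_skew12 duD) o3S12 bmapN; zmod.
  + move=> x y z; rewrite (jac_skew23 duD) o3S23 bmapN; zmod.
  + by move=> a1 a2 a3; rewrite double_jacAAA // jaA gpair0.
  + move=> a1 a2 b; rewrite double_jacAAB // c1A (mp5 mp) !subrr gpair0 //.
  + move=> a b1 b2; rewrite double_jacABB // c1B (mp6 mp) !subrr gpair0 //.
  + by move=> b1 b2 b3; rewrite double_jacBBB // jaB gpair0.
- move=> q1 q2 c; apply/eqP; rewrite -subr_eq0; apply/eqP; move: q1 q2.
  apply: (alternating2_eq0 dsum_split).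
  + move=> y x x'.
    rewrite (curvD (nabDl cD) (nabDr cD) (brkDl duD)) o3D; zmod.
  + move=> x y; rewrite (curv_skew (nabDl cD) (brk_skew duD)) o3S12; zmod.
  + by move=> a1 a2; rewrite double_curvAA // c0A subrr.
  + by move=> a b; rewrite double_curvAB // (mp4 mp) subrr.
  + by move=> b1 b2; rewrite double_curvBB // c0B subrr.
- apply: (alternating4_eq0 dsum_split).
  + move=> y z t; apply: dnab3D; [exact: nabDl cD|exact: nabDr cD|
      exact: brkDl duD|exact: o3D|exact: o3S12].
  + move=> *; apply: dnab3_skew12; [exact: nabDr cD|exact: brk_skew duD|
      exact: o3D|exact: o3S12|exact: o3S23].
  + move=> *; apply: dnab3_skew23; [exact: nabDr cD|exact: brk_skew duD|
      exact: o3D|exact: o3S12|exact: o3S23].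
  + move=> *; apply: dnab3_skew34; [exact: nabDr cD|exact: brk_skew duD|
      exact: o3D|exact: o3S23].
  + by move=> *; rewrite double_closedA4.
  + by move=> *; rewrite double_closedA3B.
  + by move=> *; rewrite double_closedA2B2 // (mp7 mp) subrr.
  + by move=> *; rewrite double_closedAB3.
  + by move=> *; rewrite double_closedB4.
Qed.

(** With the Leibniz rules of the components given, every remaining axiom is a component of some
    axiom of the double at arguments from the summands. *)
Lemma split_lie2_matched_pair : is_dull LA -> is_dull LB ->
  is_connection (rho LA) (rnab0 DA) -> is_connection (rho LA) (rnab1 DA) ->
  is_connection (rho LB) (rnab0 DB) -> is_connection (rho LB) (rnab1 DB) ->
  is_split_lie2 D ->
  [/\ is_lie_algebroid LA /\ is_lie_algebroid LB, is_rep2 LA DA, is_rep2 LB DB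
    & is_matched_pair LA LB DA DB].
Proof.
move=> duA duB cAC cAB cBC cBA [_ _ sk eq ja cu cl].
(* Equivariance along a section of [A] gives [mp2] in the component in [A] and [rep2_diff] of [DA]
   in the component in [B]. *)
have eqA a c :
    rdiff DB (rnab0 DA a c) - rnab1 DB (rdiff DA c) a = brk LA a (rdiff DB c) /\
    rnab1 DA a (rdiff DA c) = rdiff DA (rnab0 DA a c).
  have /eqP := eq (iA a) c; rewrite -subr_eq0 double_equivariantA //.
  by move=> /eqP/gpair_eq0[/subr0_eq ? /subr0_eq].
have eqB b c : rdiff DB (rnab0 DB b c) = rnab1 DB b (rdiff DB c) /\
    brk LB b (rdiff DA c) = rdiff DA (rnab0 DB b c) - rnab1 DA (rdiff DB c) b.
  have /eqP := eq (iB b) c; rewrite -subr_eq0 double_equivariantB //.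
  by move=> /eqP/gpair_eq0[/subr0_eq ? /subr0_eq].
have jac0 q1 q2 q3 : jac D q1 q2 q3 + sl_l1 D (sl_l3 D q1 q2 q3) = 0.
  by rewrite ja addNr.
have curv0 q1 q2 c :
    curv (sl_nab D) (brk D) q1 q2 c - sl_l3 D q1 q2 (sl_l1 D c) = 0.
  by rewrite cu subrr.
have jAAB a a' b := jac0 (iA a) (iA a') (iB b).
have jABB a b b' := jac0 (iA a) (iB b) (iB b').
split; [split; split=> // q1 q2 q3 | split=> // | split=> // | split].
- have := jac0 (iA q1) (iA q2) (iA q3).
  by rewrite double_jacAAA // => /gpair_eq0[].
- have := jac0 (iB q1) (iB q2) (iB q3).
  by rewrite double_jacBBB // => /gpair_eq0[].
- by move=> a c; case: (eqA a c).
- move=> a a' c; have := curv0 (iA a) (iA a') c.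
  by rewrite double_curvAA // => /subr0_eq.
- move=> a a' b; have := jAAB a a' b.
  by rewrite double_jacAAB // => /gpair_eq0[_ /subr0_eq].
- move=> a1 a2 a3 b; have := cl (iA a1) (iA a2) (iA a3) (iB b).
  by rewrite double_closedA3B.
- by move=> b c; case: (eqB b c).
- move=> b b' c; have := curv0 (iB b) (iB b') c.
  by rewrite double_curvBB // => /subr0_eq.
- move=> b b' a; have := jABB a b b'.
  by rewrite double_jacABB // => /gpair_eq0[/subr0_eq].
- move=> b1 b2 b3 a; have := cl (iA a) (iB b1) (iB b2) (iB b3).
  by rewrite double_closedAB3.
- move=> c c'; have := sk c c'.
  by rewrite double_skewE // => /subr0_eq.
- by move=> a c; case: (eqA a c).
- by move=> b c; case: (eqB b c).
- move=> a b c; have := curv0 (iA a) (iB b) c.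
  by rewrite double_curvAB // => /subr0_eq.
- move=> a a' b; have := jAAB a a' b.
  by rewrite double_jacAAB // => /gpair_eq0[/subr0_eq].
- move=> b b' a; have := jABB a b b'.
  by rewrite double_jacABB // => /gpair_eq0[_ /subr0_eq].
- move=> a1 a2 b1 b2; have := cl (iA a1) (iA a2) (iB b1) (iB b2).
  by rewrite double_closedA2B2 // => /subr0_eq.
Qed.
End MatchedPairs.

(** * The components of a given split Lie 2-algebroid *)

Section Decomposition.
Context {R : realType} {M : manifold R} {A B C : vector_bundle M}.
Variables (S : split_lie2_data (dsum A B) C).
Variables (brA : Gamma A -> Gamma A -> Gamma A).
Variables (brB : Gamma B -> Gamma B -> Gamma B).
Hypothesis S_lie2 : is_split_lie2 S.
Hypothesis S_brA : forall a a',
  brk S (gpair a 0) (gpair a' 0) = gpair (brA a a') 0.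
Hypothesis S_brB : forall b b',
  brk S (gpair 0 b) (gpair 0 b') = gpair 0 (brB b b').
Hypothesis S_l3A : forall a1 a2 a3 : Gamma A,
  sl_l3 S (gpair a1 0) (gpair a2 0) (gpair a3 0) = 0.
Hypothesis S_l3B : forall b1 b2 b3 : Gamma B,
  sl_l3 S (gpair 0 b1) (gpair 0 b2) (gpair 0 b3) = 0.

Local Notation iA := (inA A B).
Local Notation iB := (inB A B).
Local Notation pA := (prA A B).
Local Notation pB := (prB A B).
Local Notation LA := (comp_lieA S brA).
Local Notation LB := (comp_lieB S brB).
Local Notation DA := (comp_rep2A S).
Local Notation DB := (comp_rep2B S).
Let duS := sl_dull S_lie2.
Let coS := sl_connection S_lie2.

Let brAE a a' : iA (brA a a') = brk S (iA a) (iA a').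
Proof. by rewrite !inAE S_brA. Qed.

Let brBE b b' : iB (brB b b') = brk S (iB b) (iB b').
Proof. by rewrite !inBE S_brB. Qed.

Let inA_inj : injective iA.
Proof. by move=> a a'; rewrite !inAE => /gpair_inj[]. Qed.

Let inB_inj : injective iB.
Proof. by move=> b b'; rewrite !inBE => /gpair_inj[]. Qed.

Let rhoAE a f : rho LA a f = rho S (iA a) f.
Proof. exact: val_inj. Qed.

Let rhoBE b f : rho LB b f = rho S (iB b) f.
Proof. exact: val_inj. Qed.

Let pAiA a : pA (iA a) = a. Proof. by rewrite inAE prA_gpair. Qed.
Let pAiB b : pA (iB b) = 0. Proof. by rewrite inBE prA_gpair. Qed.
Let pBiA a : pB (iA a) = 0. Proof. by rewrite inAE prB_gpair. Qed.
Let pBiB b : pB (iB b) = b. Proof. by rewrite inBE prB_gpair. Qed.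

(** [iA] is injective and preserves brackets, so the bracket laws are checked in the direct sum; the
    anchor law restricts because the anchor of [LA] is that of [S] after [iA]. *)
Lemma comp_lieA_dull : is_dull LA.
Proof.
split=> [a a1 a2|a1 a2|a1 f a2|a1 a2 f]; [apply: inA_inj..|].
- by rewrite bmapD /= !brAE bmapD (brkDr duS).
- by rewrite bmapN /= !brAE (brk_skew duS).
- by rewrite bmapD !bmapZ rhoAE /= !brAE bmapZ (brk_leibniz duS).
- by rewrite !rhoAE /= brAE (brk_anchor duS).
Qed.

Lemma comp_lieB_dull : is_dull LB.
Proof.
split=> [a a1 a2|a1 a2|a1 f a2|a1 a2 f]; [apply: inB_inj..|].
- by rewrite bmapD /= !brBE bmapD (brkDr duS).
- by rewrite bmapN /= !brBE (brk_skew duS).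
- by rewrite bmapD !bmapZ rhoBE /= !brBE bmapZ (brk_leibniz duS).
- by rewrite !rhoBE /= brBE (brk_anchor duS).
Qed.

Lemma comp_rep2A_connections :
  is_connection (rho LA) (rnab0 DA) /\ is_connection (rho LA) (rnab1 DA).
Proof.
split; split=> [f a a' e|a e e'|a f e] /=; rewrite ?rhoAE.
- by rewrite bmapZD (nab_linear coS).
- exact: (nabDr coS).
- exact: (nab_leibniz coS).
(* The Leibniz term in the first argument lies in [A] and is killed by [pB], whence linearity over
   functions in [a]. *)
- rewrite bmapZD (brkDl duS) (brkZl duS) !(bmapD, bmapN, bmapZ) pBiA.
  by rewrite scaler0 subr0.
- by rewrite bmapD (brkDr duS) bmapD.
- by rewrite bmapZ (brk_leibniz duS) bmapD !bmapZ pBiB.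
Qed.

Lemma comp_rep2B_connections :
  is_connection (rho LB) (rnab0 DB) /\ is_connection (rho LB) (rnab1 DB).
Proof.
split; split=> [f b b' e|b e e'|b f e] /=; rewrite ?rhoBE.
- by rewrite bmapZD (nab_linear coS).
- exact: (nabDr coS).
- exact: (nab_leibniz coS).
- rewrite bmapZD (brkDl duS) (brkZl duS) !(bmapD, bmapN, bmapZ) pAiB.
  by rewrite scaler0 subr0.
- by rewrite bmapD (brkDr duS) bmapD.
- by rewrite bmapZ (brk_leibniz duS) bmapD !bmapZ pAiA.
Qed.

Let decompose q : q = iA (pA q) + iB (pB q).
Proof. by rewrite inAE inBE gpairD addr0 add0r gpair_pr. Qed.

Let o3D2 x z : {morph (fun y => sl_l3 S x y z) : y y' / y + y'}.
Proof. by move=> y y'; rewrite o3S12 o3D opprD -!(o3S12 _ x). Qed.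

Let o3D3 x y : {morph sl_l3 S x y : z z' / z + z'}.
Proof. by move=> z z'; rewrite o3S23 o3D2 opprD -!(o3S23 _ x y). Qed.

Let RABE a a' b : rcurv DA a a' b = sl_l3 S (iA a) (iA a') (iB b).
Proof. exact: gammaE. Qed.

Let RBAE b b' a : rcurv DB b b' a = - sl_l3 S (iB b) (iB b') (iA a).
Proof. exact: gammaE. Qed.

Lemma split_lie2_eq_double : split_lie2_eq S (bicrossproduct LA LB DA DB).
Proof.
split.
- move=> q f; rewrite -{2}(gpair_pr q) double_rhoE rhoAE rhoBE {1}(decompose q).
  exact: anchorD.
- move=> q q'; rewrite -{2}(gpair_pr q) -{2}(gpair_pr q') double_brkE /=.
  rewrite {1}(decompose q) {1}(decompose q').
  move: (pA q) (pB q) (pA q') (pB q') => a b a' b'.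
  rewrite (brkDl duS) !(brkDr duS) -brAE -brBE -[LHS]gpair_pr !bmapD.
  (* The two connections read off mixed brackets in opposite orders; skew-symmetry brings each mixed
     bracket to one order. *)
  rewrite (brk_skew duS (iA a) (iB b')) (brk_skew duS (iB b) (iA a')).
  rewrite !bmapN pAiA pAiB pBiA pBiB (brk_skew duS (iA a')).
  rewrite !bmapN !opprK.
  by congr gpair; zmod.
- move=> c; rewrite double_l1E /= -[LHS]gpair_pr.
  by congr gpair; apply: gammaE => x /=; rewrite ?opprK.
- by move=> q c; rewrite {1}(decompose q) (nabDl coS).
- move=> q1 q2 q3; rewrite -{2}(gpair_pr q1) -{2}(gpair_pr q2).
  rewrite -{2}(gpair_pr q3) double_l3E.
  rewrite {1}(decompose q1) {1}(decompose q2) {1}(decompose q3).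
  move: (pA q1) (pB q1) (pA q2) (pB q2) (pA q3) (pB q3) => a1 b1 a2 b2 a3 b3.
  have S_AAA a a' a'' : sl_l3 S (iA a) (iA a') (iA a'') = 0.
    by rewrite !inAE S_l3A.
  have S_BBB b b' b'' : sl_l3 S (iB b) (iB b') (iB b'') = 0.
    by rewrite !inBE S_l3B.
  rewrite !o3D !o3D2 !o3D3 S_AAA S_BBB !RABE !RBAE.
  (* The six mixed terms of the expansion agree with the terms of [double_l3E] up to cyclic
     permutation of the arguments. *)
  have cyc x y z : sl_l3 S x y z = sl_l3 S y z x by rewrite o3S12 o3S23 opprK.
  rewrite (cyc (iA a3) (iA a1)) (cyc (iB b1) (iA a2) (iA a3)).
  rewrite (cyc (iA a1) (iB b2) (iB b3)) (cyc (iB b3) (iB b1)).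
  zmod.
Qed.
End Decomposition.

Theorem theorem5p9 (R : realType) (M : manifold R) (A B C : vector_bundle M) :
  (forall (LA : bracket_data A) (LB : bracket_data B)
      (DA : rep2_data A C B) (DB : rep2_data B C A),
    is_lie_algebroid LA -> is_lie_algebroid LB ->
    is_rep2 LA DA -> is_rep2 LB DB ->
    is_matched_pair LA LB DA DB ->
    is_split_lie2 (bicrossproduct LA LB DA DB))
  /\
  (forall (S : split_lie2_data (dsum A B) C)
      (brA : Gamma A -> Gamma A -> Gamma A)
      (brB : Gamma B -> Gamma B -> Gamma B),
    is_split_lie2 S ->
    (forall a1 a2 : Gamma A,
      brk S (gpair a1 0) (gpair a2 0) = gpair (brA a1 a2) 0) ->
    (forall b1 b2 : Gamma B,
      brk S (gpair 0 b1) (gpair 0 b2) = gpair 0 (brB b1 b2)) ->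
    (forall a1 a2 a3 : Gamma A,
      sl_l3 S (gpair a1 0) (gpair a2 0) (gpair a3 0) = 0) ->
    (forall b1 b2 b3 : Gamma B,
      sl_l3 S (gpair 0 b1) (gpair 0 b2) (gpair 0 b3) = 0) ->
    let LA := comp_lieA S brA in
    let LB := comp_lieB S brB in
    let DA := comp_rep2A S in
    let DB := comp_rep2B S in
    [/\ is_lie_algebroid LA /\ is_lie_algebroid LB,
        is_rep2 LA DA,
        is_rep2 LB DB,
        is_matched_pair LA LB DA DB
      & split_lie2_eq S (bicrossproduct LA LB DA DB)]).
Proof.
split=> [LA LB DA DB|S brA brB S_lie2 S_brA S_brB S_l3A S_l3B LA LB DA DB].
  exact: matched_pair_split_lie2.
have [cAC cAB] := comp_rep2A_connections brA S_lie2.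
have [cBC cBA] := comp_rep2B_connections brB S_lie2.
have eqS := split_lie2_eq_double S_lie2 S_brA S_brB S_l3A S_l3B.
(* Since [S] agrees with the double of its components, that double satisfies the axioms, and those
   of the components are read off from it. *)
have [lie rA rB mp] := split_lie2_matched_pair (comp_lieA_dull S_lie2 S_brA)
  (comp_lieB_dull S_lie2 S_brB) cAC cAB cBC cBA
  (split_lie2_transfer eqS S_lie2).
by split.
Qed.
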